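(* Let $h$ be a meromorphic function on $\mathfrak{H}$ and let $\Gamma$ be a finite index subgroup of $\mathrm{SL}_2(\mathbb{Z})$. Then $h$ is $\rho$-equivariant for some triangular representation $\rho$ of $\Gamma$ if and only if the derivative $h'$ is a meromorphic weight $2$ modular form with a character of $\Gamma$.
   Context: $\mathfrak{H}$ is the complex upper half-plane. For a matrix $\begin{pmatrix}a&b\\c&d\end{pmatrix}$ and $z\in\mathbb{C}$, write $\begin{pmatrix}a&b\\c&d\end{pmatrix}\cdot z=\frac{az+b}{cz+d}$. Given a representation $\rho:\Gamma\to\mathrm{GL}_2(\mathbb{C})$, a meromorphic function $h$ on $\mathfrak{H}$ is $\rho$-equivariant for $\Gamma$ if $h(\gamma\tau)=\rho(\gamma)\cdot h(\tau)$ for all $\gamma\in\Gamma,\tau\in\mathfrak{H}$ (linear fractional action on both sides); $\rho$ is triangular if all $\rho(\gamma)$ are upper triangular. A meromorphic weight $2$ modular form with a character $\chi$ of $\Gamma$ (a homomorphism $\chi:\Gamma\to\mathbb{C}^\times$) is a meromorphic function $g$ on $\mathfrak{H}$ with $g(\gamma\tau)=\chi(\gamma)(c\tau+d)^2g(\tau)$ for all $\gamma=\begin{pmatrix}a&b\\c&d\end{pmatrix}\in\Gamma$. *)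

(* Defs.v *)
(* MathComp + MathComp-Analysis; complex numbers are R[i]
   (mathcomp-real-closed) for R : realType, viewed as a normed module over
   itself (R[i]^o), so that 'D_1 / derivable are complex derivatives. *)
From mathcomp Require Import all_boot all_order all_algebra.
From mathcomp Require Import all_classical all_reals all_analysis.
From mathcomp Require Export complex.
Export GRing.Theory Num.Theory numFieldNormedType.Exports.

Set Implicit Arguments. Unset Strict Implicit. Unset Printing Implicit Defensive.
Local Open Scope ring_scope.

Definition Cx (R : realType) := (R[i])^o.

Definition i0 : 'I_2 := ord0.
Definition i1 : 'I_2 := ord_max.

Definition upperH (R : realType) (z : Cx R) : Prop := 0 < complex.Im z.

Definition mact (R : realType) (g : 'M[int]_2) (z : Cx R) : Cx R :=
  ((g i0 i0)%:~R * z + (g i0 i1)%:~R) / ((g i1 i0)%:~R * z + (g i1 i1)%:~R).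

Definition jfac (R : realType) (g : 'M[int]_2) (z : Cx R) : Cx R :=
  (g i1 i0)%:~R * z + (g i1 i1)%:~R.

(* Riemann sphere = option (Cx R), None being the point at infinity;
   linear fractional action of a complex 2x2 matrix on it *)
Definition msph (R : realType) (M : 'M[Cx R]_2) (w : option (Cx R))
  : option (Cx R) :=
  match w with
  | Some z => if M i1 i0 * z + M i1 i1 == 0 then None
              else Some ((M i0 i0 * z + M i0 i1) / (M i1 i0 * z + M i1 i1))
  | None => if M i1 i0 == 0 then None else Some (M i0 i0 / M i1 i0)
  end.

Definition meromorphicH (R : realType) (h : Cx R -> option (Cx R)) : Prop :=
  forall z0 : Cx R, upperH z0 ->
  exists r : Cx R, 0 < r /\
  exists (g : Cx R -> Cx R) (n : nat),
    (forall z : Cx R, `|z - z0| < r -> upperH z /\ derivable g z 1) /\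
    ((0 < n)%N -> g z0 != 0) /\
    (forall z : Cx R, `|z - z0| < r ->
       h z = if (z == z0) && (0 < n)%N then None
             else Some (g z / (z - z0) ^+ n)).

Definition mderiv (R : realType) (h : Cx R -> option (Cx R))
  : Cx R -> option (Cx R) :=
  fun z => if h z is Some _ then Some ('D_1 (fun w => odflt 0 (h w)) z)
           else None.

Definition SL2Z (g : 'M[int]_2) : Prop := \det g = 1.

Definition fin_index_subgroup (Gam : 'M[int]_2 -> Prop) : Prop :=
  (forall g, Gam g -> SL2Z g) /\
  Gam 1%:M /\
  (forall g k, Gam g -> Gam k -> Gam (g *m k)) /\
  (forall g, Gam g -> Gam (invmx g)) /\
  exists s : seq 'M[int]_2,
    forall g, SL2Z g -> exists2 r, r \in s & exists2 k, Gam k & g = k *m r.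

Definition is_repr (R : realType) (Gam : 'M[int]_2 -> Prop)
  (rho : 'M[int]_2 -> 'M[Cx R]_2) : Prop :=
  (forall g, Gam g -> rho g \in unitmx) /\
  (forall g k, Gam g -> Gam k -> rho (g *m k) = rho g *m rho k).

Definition triangular_repr (R : realType) (Gam : 'M[int]_2 -> Prop)
  (rho : 'M[int]_2 -> 'M[Cx R]_2) : Prop :=
  forall g, Gam g -> rho g i1 i0 = 0.

Definition equivariant (R : realType) (Gam : 'M[int]_2 -> Prop)
  (rho : 'M[int]_2 -> 'M[Cx R]_2) (h : Cx R -> option (Cx R)) : Prop :=
  forall g z, Gam g -> upperH z -> h (mact g z) = msph (rho g) (h z).

Definition is_character (R : realType) (Gam : 'M[int]_2 -> Prop)
  (chi : 'M[int]_2 -> Cx R) : Prop :=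
  (forall g, Gam g -> chi g != 0) /\
  (forall g k, Gam g -> Gam k -> chi (g *m k) = chi g * chi k).

Definition mero_modform2 (R : realType) (Gam : 'M[int]_2 -> Prop)
  (chi : 'M[int]_2 -> Cx R) (f : Cx R -> option (Cx R)) : Prop :=
  meromorphicH f /\
  forall g z, Gam g -> upperH z ->
    f (mact g z) = omap (fun w => chi g * jfac g z ^+ 2 * w) (f z).

(* Main.v *)
(* If h o g = (a h + b) / d, the chain rule gives
   h'(g z) = (a / d) (c z + d)^2 h'(z), so a / d is the character; conversely, if
   h' has weight 2 and character chi, then h o g - chi(g) h has derivative zero
   off a discrete set, hence is a constant b(g), and [[chi, b], [0, 1]] is the
   representation. The analytic content is that h' is again meromorphic although
   holomorphy only means complex differentiability: by Goursat's theorem for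
   rectangles and Cauchy's formula, f(w) is near each point the quotient of the
   contour integrals of f(z) / (z - w) and of 1 / (z - w), both of which may be
   differentiated twice under the integral sign. *)
Require Import Defs.
From mathcomp Require Import all_boot all_order all_algebra.
From mathcomp Require Import all_classical all_reals all_analysis.
From mathcomp Require Import ring lra.
Import Order.TTheory.
Set Implicit Arguments.
Unset Strict Implicit.
Unset Printing Implicit Defensive.
Local Open Scope ring_scope.
Import ComplexField.Normc.
Local Open Scope complex_scope.

(** * Complex differentiability in terms of the real-valued norm *)

Section ComplexNorm.
Variable R : realType.
Local Notation C := (Cx R).
Local Notation N := (@normc R).
Local Notation Re := (@complex.Re R).
Local Notation Im := (@complex.Im R).

(** In f = A / B the winding integral B is differentiated along with A: f' = (A1 B - A B1) / B^2,
    where A1 and B1 are contour integrals that can be differentiated again. What B has to satisfy is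
    being nonzero near the centre. Poles are matched through [None]. A triangular matrix fixes
    infinity, and a pole of order n of h becomes a pole of order n + 1 of h', so h and h' are
    infinite at the same points; the weight 2 law of h' therefore shows by itself that h o g and h
    have the same poles. Constancy of h o g - chi(g) h is first obtained on punctured discs, by
    going round the centre; the local values are then glued along segments, the half-plane being
    convex. Multiplicativity of the matrices amounts to the cocycle identity b(gk) = chi(g) b(k) +
    b(g), which is read off at a single point where h is finite. *)

Lemma normCE (z : C) : `|z| = (N z)%:C. Proof. by []. Qed.

Lemma normC_lt (z : C) (e : R) : (`|z| < e%:C :> C) = (N z < e).
Proof. by rewrite normCE ltcR. Qed.

Lemma normC_le (z : C) (e : R) : (`|z| <= e%:C :> C) = (N z <= e).
Proof. by rewrite normCE lecR. Qed.

Lemma normc_ge0 (z : C) : 0 <= N z.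
Proof. by rewrite -lecR -normCE normr_ge0. Qed.

Lemma normcB (z w : C) : N (z - w) = N (w - z).
Proof. by rewrite -opprB normcN. Qed.

Lemma normc_gt0 (z : C) : (0 < N z) = (z != 0).
Proof. by rewrite -ltcR -normCE normr_gt0. Qed.

Lemma normc_tri (x y z : C) : N (x - z) <= N (x - y) + N (y - z).
Proof. by rewrite (_ : x - z = (x - y) + (y - z)) ?le_normcD//; ring. Qed.

Lemma normcX (z : C) n : N (z ^+ n) = N z ^+ n.
Proof. by elim: n => [|n ih]; rewrite ?expr0 ?normc1// !exprS normcM ih. Qed.

Lemma ReD (z w : C) : Re (z + w) = Re z + Re w. Proof. by case: z w => [? ?] []. Qed.
Lemma ImD (z w : C) : Im (z + w) = Im z + Im w. Proof. by case: z w => [? ?] []. Qed.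
Lemma ReB (z w : C) : Re (z - w) = Re z - Re w. Proof. by case: z w => [? ?] []. Qed.
Lemma ImB (z w : C) : Im (z - w) = Im z - Im w. Proof. by case: z w => [? ?] []. Qed.
Lemma ReM (z w : C) : Re (z * w) = Re z * Re w - Im z * Im w.
Proof. by case: z w => [? ?] []. Qed.
Lemma ImM (z w : C) : Im (z * w) = Re z * Im w + Im z * Re w.
Proof. by case: z w => [? ?] []. Qed.

Lemma normc_sqr (z : C) : N z ^+ 2 = Re z ^+ 2 + Im z ^+ 2.
Proof. by case: z => a b; rewrite /= sqr_sqrtr// addr_ge0// sqr_ge0. Qed.

Lemma Re_le_normc (z : C) : `|Re z| <= N z.
Proof.
rewrite -(ler_pXn2r (ltn0Sn 1)) ?nnegrE ?normc_ge0// normc_sqr real_normK ?num_real//.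
by rewrite lerDl sqr_ge0.
Qed.

Lemma Im_le_normc (z : C) : `|Im z| <= N z.
Proof.
rewrite -(ler_pXn2r (ltn0Sn 1)) ?nnegrE ?normc_ge0// normc_sqr real_normK ?num_real//.
by rewrite lerDr sqr_ge0.
Qed.

Lemma normc_le_ReIm (z : C) : N z <= `|Re z| + `|Im z|.
Proof.
rewrite -(ler_pXn2r (ltn0Sn 1)) ?nnegrE ?normc_ge0 ?addr_ge0// normc_sqr.
rewrite sqrrD !real_normK ?num_real// lerD2r lerDl mulrn_wge0// mulr_ge0.
Qed.

Definition ccont (f : C -> C) (z : C) := forall e : R, 0 < e ->
  exists2 d : R, 0 < d & forall w : C, N (w - z) < d -> N (f w - f z) < e.

(** Radii of balls in [R[i]] are themselves complex numbers; a positive one is real, hence equal to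
    its real part. *)
Lemma nbhs_normcP (P : C -> Prop) (z : C) :
  (\forall w \near z, P w) <->
  exists2 d : R, 0 < d & forall w : C, N (w - z) < d -> P w.
Proof.
split.
  move=> /nbhs_ballP[e e0 h].
  have ei : e = (Re e)%:C by rewrite RRe_real// gtr0_real.
  exists (Re e); first by rewrite -ltcR -ei.
  move=> w wz; apply: h; rewrite /ball/= ei normC_lt.
  by rewrite normcB.
move=> [d d0 h]; apply/nbhs_ballP; exists d%:C; first by rewrite /= ltcR.
by move=> w; rewrite /ball/= normC_lt normcB => /h.
Qed.

(** The division-free form of the derivative, in which w = z is allowed and errors can be added; all
    later estimates go through it. *)
Lemma is_derive_normcP (f : C -> C) (z l : C) :
  is_derive z (1 : C) f l <->
  forall e : R, 0 < e -> exists2 d : R, 0 < d &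
    forall w : C, N (w - z) < d -> N (f w - f z - l * (w - z)) <= e * N (w - z).
Proof.
split.
  case=> df; rewrite /derive => dl e e0.
  have := df; rewrite /derivable => /cvg_ex[/= l' hl'].
  have ll' : l' = l by rewrite -dl; apply/esym/cvg_lim.
  rewrite {}ll' {l'} in hl'.
  move/cvgrPdist_le: hl' => /(_ e%:C); rewrite ltcR => /(_ e0).
  move=> /nbhs_ballP[d' d'0 h].
  have ei : d' = (Re d')%:C by rewrite RRe_real// gtr0_real.
  exists (Re d'); first by rewrite -ltcR -ei.
  move=> w wz; have [->|wz0] := eqVneq w z.
    by rewrite !subrr mulr0 subrr normc0 mulr0.
  have wz1 : w - z != 0 by rewrite subr_eq0.
  have := h (w - z); rewrite /ball/= ei normC_lt sub0r normcN => /(_ wz wz1).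
  rewrite [_%:A]mulr1 subrK [_^-1 *: _]/(_^-1 * _) => h1.
  have -> : f w - f z - l * (w - z) = - (l - (w - z)^-1 * (f w - f z)) * (w - z).
    by field.
  rewrite normcM normcN ler_wpM2r ?normc_ge0//.
  by rewrite -normC_le.
move=> h.
have cv : (k^-1 *: ((f \o shift z) (k *: (1 : C)) - f z) @[k --> (0 : (R[i] : numFieldType))^'] --> l)%classic.
  apply/cvgrPdist_le => e e0.
  have ei : e = (Re e)%:C by rewrite RRe_real// gtr0_real.
  have /h[d d0 hd] : 0 < Re e by rewrite -ltcR -ei.
  apply/nbhs_ballP; exists d%:C; first by rewrite /= ltcR.
  move=> k; rewrite /ball/= normC_lt sub0r normcN => kd k0.
  rewrite [_%:A]mulr1 [_^-1 *: _]/(_^-1 * _) ei normC_le.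
  have := hd (k + z); rewrite addrK => /(_ kd) h1.
  have -> : l - k^-1 * (f (k + z) - f z) = - (f (k + z) - f z - l * k) / k by field.
  by rewrite normcM normcN normcV ler_pdivrMr// normc_gt0.
apply: DeriveDef; first by apply/cvg_ex; exists l.
exact/cvg_lim.
Qed.

Lemma derivable_ccont (f : C -> C) (z : C) : derivable f z 1 -> ccont f z.
Proof.
move=> /derivableP/is_derive_normcP h e e0.
have [d d0 hd] := h 1 ltr01.
set l := 'D_1 f z in hd.
have M0 : 0 < 1 + N l by rewrite ltr_wpDr// normc_ge0.
exists (Num.min d (e / (1 + N l))); first by rewrite lt_min d0 divr_gt0.
move=> w; rewrite lt_min => /andP[/hd h1]; rewrite ltr_pdivlMr// => h2.
apply: le_lt_trans h2.
have -> : f w - f z = (f w - f z - l * (w - z)) + l * (w - z) by ring.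
by apply: (le_trans (le_normcD _ _)); rewrite normcM; lra.
Qed.

End ComplexNorm.

(** * Bisection of segments and rectangles *)

Section Bisection.
Variable R : realType.

(** Every left end lies below every right end, so the supremum of the left ends belongs to all the
    intervals. *)
Lemma nested_intervals (u l : nat -> R) :
  (forall n, u n <= u n.+1) -> (forall n, u n.+1 + l n.+1 <= u n + l n) ->
  (forall n, 0 <= l n) -> exists p, forall n, u n <= p <= u n + l n.
Proof.
move=> hu hl l0.
have mu m n : (m <= n)%N -> u m <= u n.
  by move: m n; apply/nondecreasing_seqP.
have ml m n : (m <= n)%N -> u n + l n <= u m + l m.
  by move: m n; apply/(@nonincreasing_seqP _ _ (fun n => u n + l n)).
have ub m n : u m <= u n + l n.
  have [mn|/ltnW nm] := leqP m n.
    by apply: (le_trans (mu _ _ mn)); rewrite lerDl.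
  by apply: le_trans (ml _ _ nm); rewrite lerDl.
have ubr n : ubound (range u) (u n + l n) by move=> _ [m _ <-].
exists (sup (range u)) => n; apply/andP; split.
  by apply: ub_le_sup; [exists (u 0%N + l 0%N) | exists n].
by apply: ge_sup => //; exists (u 0%N), 0%N.
Qed.

Lemma half_pow (t : R) n : t / 2 ^+ n = t / 2 ^+ n.+1 + t / 2 ^+ n.+1.
Proof. by rewrite exprS; field; rewrite expf_neq0// pnatr_eq0. Qed.

Lemma half_pow_lt (k d : R) : 0 < k -> 0 < d ->
  exists n0, forall n, (n0 <= n)%N -> k / 2 ^+ n < d.
Proof.
move=> k0 d0; have := cvg_geometric k (_ : `|2^-1 : R| < 1).
rewrite ger0_norm ?invr_ge0// invf_lt1// ltr1n => /(_ isT).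
move/cvgrPdist_lt => /(_ _ d0)[n0 _ hn]; exists n0 => n /hn.
rewrite /geometric/= sub0r normrN ger0_norm; first by rewrite exprVn.
by rewrite mulr_ge0// ?exprn_ge0// ?invr_ge0// ltW.
Qed.

(* With h = 0 this is the bisection principle on a segment. *)
Lemma quarter_ind (P : nat -> R -> R -> Prop) (w h x0 y0 : R) :
  0 <= w -> 0 <= h ->
  (forall n x y,
     P n.+1 x y -> P n.+1 (x + w / 2 ^+ n.+1) y ->
     P n.+1 x (y + h / 2 ^+ n.+1) ->
     P n.+1 (x + w / 2 ^+ n.+1) (y + h / 2 ^+ n.+1) -> P n x y) ->
  (forall p q, x0 <= p <= x0 + w -> y0 <= q <= y0 + h ->
     exists n0, forall n x y, (n0 <= n)%N ->
       x0 <= x -> x + w / 2 ^+ n <= x0 + w ->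
       y0 <= y -> y + h / 2 ^+ n <= y0 + h ->
       x <= p <= x + w / 2 ^+ n -> y <= q <= y + h / 2 ^+ n -> P n x y) ->
  P 0%N x0 y0.
Proof.
move=> w0 h0 Pq Ploc; apply: contrapT => nP0.
have pos (a : R) n : 0 <= a -> 0 <= a / 2 ^+ n.
  by move=> a0; rewrite divr_ge0// exprn_ge0.
(* The last clause passes the failure of [P] on to the chosen quarter. Being an implication, it is
   vacuous on cells where [P] holds, so a successor can be chosen for every cell. *)
pose good n (c c' : R * R) :=
  [/\ c.1 <= c'.1, c'.1 + w / 2 ^+ n.+1 <= c.1 + w / 2 ^+ n,
      c.2 <= c'.2, c'.2 + h / 2 ^+ n.+1 <= c.2 + h / 2 ^+ n &
      ~ P n c.1 c.2 -> ~ P n.+1 c'.1 c'.2].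
have /choice[F HF] : forall nc : nat * (R * R), exists c', good nc.1 nc.2 c'.
  move=> [n [x y]] /=; apply: contrapT => nex.
  have hw := pos w n.+1 w0; have hh := pos h n.+1 h0.
  have [Pn|nPn] := pselect (P n x y).
    by apply: nex; exists (x, y); split => //=; rewrite lerD2l (half_pow _ n); lra.
  (* If no quarter inherited the failure, all four would satisfy [P], and then so would the cell. *)
  have bad x' y' : x <= x' -> x' + w / 2 ^+ n.+1 <= x + w / 2 ^+ n ->
      y <= y' -> y' + h / 2 ^+ n.+1 <= y + h / 2 ^+ n -> P n.+1 x' y'.
    by move=> ? ? ? ?; apply: contrapT => nP; apply: nex; exists (x', y').
  by apply: nPn; apply: Pq; apply: bad; rewrite ?(half_pow _ n); lra.
pose s := fix s n := if n is m.+1 then F (m, s m) else (x0, y0).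
have Hs n : good n (s n) (s n.+1) by apply: HF (n, s n).
have nP n : ~ P n (s n).1 (s n).2.
  by elim: n => // n ih; have [_ _ _ _] := Hs n; apply.
have [p hp] : exists p, forall n, (s n).1 <= p <= (s n).1 + w / 2 ^+ n.
  by apply: (@nested_intervals (fun n => (s n).1) (fun n => w / 2 ^+ n)) => n;
    [have [] := Hs n|have [] := Hs n|exact: pos].
have [q hq] : exists q, forall n, (s n).2 <= q <= (s n).2 + h / 2 ^+ n.
  by apply: (@nested_intervals (fun n => (s n).2) (fun n => h / 2 ^+ n)) => n;
    [have [] := Hs n|have [] := Hs n|exact: pos].
have inn n : [/\ x0 <= (s n).1, (s n).1 + w / 2 ^+ n <= x0 + w,
    y0 <= (s n).2 & (s n).2 + h / 2 ^+ n <= y0 + h].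
  elim: n => [|n [a b c d]]; first by rewrite /= expr0 !divr1.
  have [a' b' c' d' _] := Hs n.
  by split; [exact: le_trans a a'|exact: le_trans b' b|exact: le_trans c c'
    |exact: le_trans d' d].
have := hp 0%N; have := hq 0%N; rewrite /= !expr0 !divr1 => hq0 hp0.
have [n0 Hn] := Ploc _ _ hp0 hq0.
by apply: (nP n0); have [a b c d] := inn n0; apply: Hn.
Qed.

End Bisection.

(** * Integrals of continuous complex-valued functions on a segment *)

Section ComplexIntegral.
Variable R : realType.
Local Notation C := (Cx R).
Local Notation N := (@normc R).
Local Notation Re := (@complex.Re R).
Local Notation Im := (@complex.Im R).
Local Notation mu := (@lebesgue_measure R).

Definition rcont (f : R -> C) (t : R) := forall e : R, 0 < e ->
  exists2 d : R, 0 < d & forall s : R, `|s - t| < d -> N (f s - f t) < e.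

(** Continuity is two-sided at the endpoints too: the integrands are restrictions to a line of
    functions continuous in the plane at each point of the segment. *)
Definition rcont_on (a b : R) (f : R -> C) :=
  forall t, a <= t <= b -> rcont f t.

Lemma rcont_onZ (a b : R) (k : C) f :
  rcont_on a b f -> rcont_on a b (fun t => k * f t).
Proof.
move=> hf t /hf ht e e0; have k0 : 0 < N k + 1 by rewrite ltr_wpDl// normc_ge0.
have [d d0 h] := ht _ (divr_gt0 e0 k0); exists d => // s /h.
rewrite ltr_pdivlMr// -mulrBr normcM => /(le_lt_trans _); apply.
by rewrite mulrC ler_wpM2l ?normc_ge0// lerDl.
Qed.

Definition cint (a b : R) (f : R -> C) : C :=
  (\int[mu]_(x in `[a, b]) Re (f x)) +i* (\int[mu]_(x in `[a, b]) Im (f x)).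

Lemma rcont_onS a b a' b' f :
  a <= a' -> b' <= b -> rcont_on a b f -> rcont_on a' b' f.
Proof.
by move=> aa bb h t /andP[t1 t2]; apply: h; rewrite (le_trans aa)// (le_trans t2).
Qed.

(** Here [p] stands for [Re], [Im] or the norm; the Lipschitz bound is what these share and what
    carries continuity over to a real-valued function. *)
Lemma rcont_within (a b : R) (f : R -> C) (p : C -> R) :
  (forall z w, `|p z - p w| <= N (z - w)) ->
  rcont_on a b f -> {within `[a, b], continuous (p \o f)}%classic.
Proof.
move=> hp hf; apply: continuous_in_subspaceT => t.
rewrite inE/= in_itv/= => /hf ht.
apply/cvgrPdist_lt => e /ht[d d0 hd]; apply/nbhs_ballP; exists d => // s.
rewrite /ball/= => ts; apply: (le_lt_trans (hp _ _)).
by rewrite normcB; apply: hd; rewrite distrC.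
Qed.

Lemma Re_lipschitz (z w : C) : `|Re z - Re w| <= N (z - w).
Proof. by rewrite -ReB Re_le_normc. Qed.

Lemma Im_lipschitz (z w : C) : `|Im z - Im w| <= N (z - w).
Proof. by rewrite -ImB Im_le_normc. Qed.

Lemma rcont_integrable (a b : R) (f : R -> C) (p : C -> R) :
  (forall z w, `|p z - p w| <= N (z - w)) ->
  rcont_on a b f -> (mu.-integrable `[a, b] (EFin \o (p \o f)))%classic.
Proof.
move=> hp hf; apply: continuous_compact_integrable.
  exact: segment_compact.
exact: rcont_within.
Qed.

Lemma rcont_bounded (a b : R) (f : R -> C) : a <= b -> rcont_on a b f ->
  exists2 M : R, 0 < M & forall t, a <= t <= b -> N (f t) <= M.
Proof.
move=> ab hf.
have hN (z w : C) : `|N z - N w| <= N (z - w).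
  rewrite ler_norml lerBrDr lerBlDr; apply/andP; split.
    by rewrite addrC lerBlDl; have := normc_tri w z 0; rewrite !subr0 normcB.
  by have := normc_tri z w 0; rewrite !subr0.
have [c _ hc] := EVT_max ab (rcont_within hN hf).
exists (N (f c) + 1) => [|t tab]; first by rewrite ltr_wpDl// normc_ge0.
by apply: (@le_trans _ _ (N (f c))); [apply: hc; rewrite in_itv|rewrite lerDl].
Qed.

Let mI (a b : R) : measurable (`[a, b]%classic : set R).
Proof. exact: measurable_itv. Qed.

Lemma cintD (a b : R) (f g : R -> C) : rcont_on a b f -> rcont_on a b g ->
  cint a b (fun t => f t + g t) = cint a b f + cint a b g.
Proof.
move=> hf hg; rewrite /cint; apply/eqP; rewrite eq_complex /=; apply/andP; split.
  under eq_Rintegral do rewrite ReD.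
  by rewrite RintegralD//; apply: rcont_integrable => //; exact: Re_lipschitz.
under eq_Rintegral do rewrite ImD.
by rewrite RintegralD//; apply: rcont_integrable => //; exact: Im_lipschitz.
Qed.

Lemma cintZ (a b : R) (k : C) (f : R -> C) : rcont_on a b f ->
  cint a b (fun t => k * f t) = k * cint a b f.
Proof.
move=> hf.
have ir := rcont_integrable Re_lipschitz hf.
have ii := rcont_integrable Im_lipschitz hf.
have iZ c (p : C -> R) : (mu.-integrable `[a, b] (EFin \o (p \o f)))%classic ->
    (mu.-integrable `[a, b] (EFin \o (fun x => c * p (f x))))%classic.
  move=> h; rewrite (_ : _ \o _ = fun x => (c%:E * (EFin \o (p \o f)) x)%E)//.
  exact: integrableZl.
case: k => k1 k2; rewrite /cint; apply/eqP; rewrite eq_complex /=.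
apply/andP; split.
  under eq_Rintegral do rewrite ReM/=.
  by rewrite RintegralB ?RintegralZl//; [exact: iZ|exact: iZ].
under eq_Rintegral do rewrite ImM/=.
by rewrite RintegralD ?RintegralZl//; [exact: iZ|exact: iZ].
Qed.

Lemma eq_cint (a b : R) (f g : R -> C) :
  (forall t, a <= t <= b -> f t = g t) -> cint a b f = cint a b g.
Proof.
by move=> fg; rewrite /cint; congr (_ +i* _); apply: eq_Rintegral => x;
  rewrite inE/= in_itv/= => /fg ->.
Qed.

Lemma cint_split (a b c : R) (f : R -> C) : a <= b <= c -> rcont_on a c f ->
  cint a c f = cint a b f + cint b c f.
Proof.
move=> /andP[ab bc] hf.
have key (p : C -> R) : (forall z w, `|p z - p w| <= N (z - w)) ->
    (\int[mu]_(x in `[a, c]) p (f x) =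
     \int[mu]_(x in `[a, b]) p (f x) + \int[mu]_(x in `[b, c]) p (f x))%classic.
  move=> hp; have i1 := rcont_integrable hp hf.
  have i2 := rcont_integrable hp (rcont_onS ab (lexx c) hf).
  (* Opening the second interval at b makes the two pieces disjoint without changing the
     integral. *)
  rewrite -[X in _ + X]Rintegral_itv_obnd_cbnd.
    by rewrite -(@Rintegral_itvB _ (p \o f) (BLeft a) (BRight c) b)//=;
      rewrite ?bnd_simp//; rewrite addrC subrK.
  by apply: integrableS i2 => //; apply: subset_itvr; rewrite bnd_simp.
by congr (_ +i* _); apply: key; [exact: Re_lipschitz|exact: Im_lipschitz].
Qed.

Lemma Rintegral_itv_cst (a b : R) (k : R) : a <= b ->
  (\int[mu]_(x in `[a, b]) k = k * (b - a))%classic.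
Proof.
move=> ab; rewrite Rintegral_cst//= lebesgue_measure_itv/= lte_fin.
by case: ltgtP ab => // -> _; rewrite subrr.
Qed.

Lemma cint_cst (a b : R) (k : C) : a <= b ->
  cint a b (fun=> k) = k * (b - a)%:C.
Proof.
move=> ab; rewrite /cint !Rintegral_itv_cst//.
by apply/eqP; rewrite eq_complex ReM ImM/= !mulr0 subr0 add0r !eqxx.
Qed.

(** The factor 2 comes from estimating the real and imaginary parts separately; every use has a
    constant to spare. *)
Lemma cint_bound (a b M : R) (f : R -> C) : a <= b -> rcont_on a b f ->
  (forall t, a <= t <= b -> N (f t) <= M) ->
  N (cint a b f) <= 2 * M * (b - a).
Proof.
move=> ab hf hM.
have key (p : C -> R) : (forall z w, `|p z - p w| <= N (z - w)) ->
    (forall z, `|p z| <= N z) ->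
    (`| \int[mu]_(x in `[a, b]) p (f x) | <= M * (b - a))%classic.
  move=> hp hp2; have i1 := rcont_integrable hp hf.
  apply: (le_trans (le_normr_Rintegral _ i1)) => //.
  rewrite -(Rintegral_itv_cst M ab); apply: le_Rintegral => //.
  - exact: integrable_norm i1.
  - apply: continuous_compact_integrable; first exact: segment_compact.
    by apply: continuous_subspaceT => x; exact: cvg_cst.
  - move=> x /=; rewrite in_itv/= => /hM; exact: le_trans.
apply: (le_trans (normc_le_ReIm _)).
rewrite -mulrA mulr_natl mulr2n; apply: lerD.
  exact: key Re_lipschitz (@Re_le_normc R).
exact: key Im_lipschitz (@Im_le_normc R).
Qed.

(** Serves to keep the winding integral away from zero, for which a lower bound on one component is
    enough. *)
Lemma Im_cint_ge (a b m : R) (f : R -> C) : a <= b -> rcont_on a b f ->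
  (forall t, a <= t <= b -> m <= Im (f t)) ->
  m * (b - a) <= Im (cint a b f).
Proof.
move=> ab hf hm; rewrite -(Rintegral_itv_cst m ab) /=.
apply: le_Rintegral => //.
- apply: continuous_compact_integrable; first exact: segment_compact.
  by apply: continuous_subspaceT => x; exact: cvg_cst.
- exact: rcont_integrable Im_lipschitz hf.
Qed.

End ComplexIntegral.

(** * Goursat's theorem *)

Section Rectangle.
Variable R : realType.
Local Notation C := (Cx R).
Local Notation N := (@normc R).
Local Notation Re := (@complex.Re R).
Local Notation Im := (@complex.Im R).

Definition inrect (a b c d : R) (z : C) := (a <= Re z <= b) && (c <= Im z <= d).

Definition onrect (a b c d : R) (z : C) := inrect a b c d z &&
  [|| Re z == a, Re z == b, Im z == c | Im z == d].

(* The integral of f(z) dz counterclockwise along the boundary. *)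
Definition rint (a b c d : R) (f : C -> C) : C :=
  cint a b (fun x => f (x +i* c)) - cint a b (fun x => f (x +i* d)) +
  'i * (cint c d (fun y => f (b +i* y)) - cint c d (fun y => f (a +i* y))).

Lemma normc_hor (s t y : R) : N ((s +i* y : C) - (t +i* y)) = `|s - t|.
Proof. by rewrite /= subrr expr0n/= addr0 sqrtr_sqr. Qed.

Lemma normc_ver (s t x : R) : N ((x +i* s : C) - (x +i* t)) = `|s - t|.
Proof. by rewrite /= subrr expr0n/= add0r sqrtr_sqr. Qed.

Lemma ccont_hor (a b y : R) (f : C -> C) :
  (forall x, a <= x <= b -> ccont f (x +i* y)) ->
  rcont_on a b (fun x => f (x +i* y)).
Proof.
move=> h t /h ht e /ht[d d0 hd]; exists d => // s st; apply: hd.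
by rewrite normc_hor.
Qed.

Lemma ccont_ver (c d x : R) (f : C -> C) :
  (forall y, c <= y <= d -> ccont f (x +i* y)) ->
  rcont_on c d (fun y => f (x +i* y)).
Proof.
move=> h t /h ht e /ht[d' d0 hd]; exists d' => // s st; apply: hd.
by rewrite normc_ver.
Qed.

Lemma rect_sides (a b c d : R) (f : C -> C) : a <= b -> c <= d ->
  (forall z, onrect a b c d z -> ccont f z) ->
  [/\ rcont_on a b (fun x => f (x +i* c)), rcont_on a b (fun x => f (x +i* d)),
      rcont_on c d (fun y => f (b +i* y)) & rcont_on c d (fun y => f (a +i* y))].
Proof.
move=> ab cd hf; split; (apply: ccont_hor || apply: ccont_ver) => t ht;
  by apply: hf; rewrite /onrect /inrect /= ht ?lexx ?ab ?cd ?eqxx ?orbT.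
Qed.

Lemma rintD (a b c d : R) (f g : C -> C) : a <= b -> c <= d ->
  (forall z, onrect a b c d z -> ccont f z) ->
  (forall z, onrect a b c d z -> ccont g z) ->
  rint a b c d (fun z => f z + g z) = rint a b c d f + rint a b c d g.
Proof.
move=> ab cd /(rect_sides ab cd)[f1 f2 f3 f4] /(rect_sides ab cd)[g1 g2 g3 g4].
by rewrite /rint !cintD//; ring.
Qed.

Lemma rintZ (a b c d : R) (k : C) (f : C -> C) : a <= b -> c <= d ->
  (forall z, onrect a b c d z -> ccont f z) ->
  rint a b c d (fun z => k * f z) = k * rint a b c d f.
Proof.
move=> ab cd /(rect_sides ab cd)[f1 f2 f3 f4].
by rewrite /rint !cintZ//; ring.
Qed.

Lemma eq_rint (a b c d : R) (f g : C -> C) : a <= b -> c <= d ->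
  (forall z, onrect a b c d z -> f z = g z) -> rint a b c d f = rint a b c d g.
Proof.
move=> ab cd fg; rewrite /rint.
congr (_ - _ + 'i * (_ - _)); apply: eq_cint => t ht;
  by apply: fg; rewrite /onrect /inrect /= ht ?lexx ?ab ?cd ?eqxx ?orbT.
Qed.

(** The constant 4 is the factor 2 of [cint_bound] times the two sides in each direction. *)
Lemma rint_bound (a b c d M : R) (f : C -> C) : a <= b -> c <= d ->
  (forall z, onrect a b c d z -> ccont f z) ->
  (forall z, onrect a b c d z -> N (f z) <= M) ->
  N (rint a b c d f) <= 4 * M * ((b - a) + (d - c)).
Proof.
move=> ab cd /(rect_sides ab cd)[f1 f2 f3 f4] hM.
have Ni : N 'i = 1 by rewrite /= expr0n/= add0r expr1n sqrtr1.
have B (p q : R) (g : R -> C) : p <= q -> rcont_on p q g ->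
    (forall t, p <= t <= q -> N (g t) <= M) -> N (cint p q g) <= 2 * M * (q - p).
  exact: cint_bound.
have h1 : N (cint a b (fun x => f (x +i* c))) <= 2 * M * (b - a).
  by apply: B => // t ht; apply: hM;
    rewrite /onrect /inrect /= ht ?lexx ?ab ?cd ?eqxx ?orbT.
have h2 : N (cint a b (fun x => f (x +i* d))) <= 2 * M * (b - a).
  by apply: B => // t ht; apply: hM;
    rewrite /onrect /inrect /= ht ?lexx ?ab ?cd ?eqxx ?orbT.
have h3 : N (cint c d (fun y => f (b +i* y))) <= 2 * M * (d - c).
  by apply: B => // t ht; apply: hM;
    rewrite /onrect /inrect /= ht ?lexx ?ab ?cd ?eqxx ?orbT.
have h4 : N (cint c d (fun y => f (a +i* y))) <= 2 * M * (d - c).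
  by apply: B => // t ht; apply: hM;
    rewrite /onrect /inrect /= ht ?lexx ?ab ?cd ?eqxx ?orbT.
apply: (le_trans (le_normcD _ _)); rewrite normcM Ni mul1r.
have -> : 4 * M * (b - a + (d - c)) =
    (2 * M * (b - a) + 2 * M * (b - a)) + (2 * M * (d - c) + 2 * M * (d - c)).
  by ring.
apply: lerD; apply: (le_trans (le_normcD _ _)); rewrite normcN; exact: lerD.
Qed.

(** The common side is traversed once in each direction and cancels. *)
Lemma rint_splitx (a m b c d : R) (f : C -> C) : a <= m <= b -> c <= d ->
  (forall z, inrect a b c d z -> ccont f z) ->
  rint a b c d f = rint a m c d f + rint m b c d f.
Proof.
move=> /andP[am mb] cd hf; have ab := le_trans am mb.
have S y : c <= y <= d -> cint a b (fun x => f (x +i* y)) =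
    cint a m (fun x => f (x +i* y)) + cint m b (fun x => f (x +i* y)).
  move=> hy; apply: cint_split; first by rewrite am.
  by apply: ccont_hor => x hx; apply: hf; rewrite /inrect /= hx.
by rewrite /rint !S ?lexx ?cd//; ring.
Qed.

Lemma rint_splity (a b c m d : R) (f : C -> C) : a <= b -> c <= m <= d ->
  (forall z, inrect a b c d z -> ccont f z) ->
  rint a b c d f = rint a b c m f + rint a b m d f.
Proof.
move=> ab /andP[cm md] hf; have cd := le_trans cm md.
have S x : a <= x <= b -> cint c d (fun y => f (x +i* y)) =
    cint c m (fun y => f (x +i* y)) + cint m d (fun y => f (x +i* y)).
  move=> hx; apply: cint_split; first by rewrite cm.
  by apply: ccont_ver => y hy; apply: hf; rewrite /inrect /= hx.
by rewrite /rint !S ?lexx ?ab//; ring.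
Qed.

Lemma ccont_cst (k z : C) : ccont (fun=> k) z.
Proof. by move=> e e0; exists 1 => // w _; rewrite subrr normc0. Qed.

Lemma ccont_id (z : C) : ccont id z.
Proof. by move=> e e0; exists e. Qed.

Lemma ccontD (f g : C -> C) (z : C) :
  ccont f z -> ccont g z -> ccont (fun w => f w + g w) z.
Proof.
move=> cf cg e e0; have e2 : 0 < e / 2 by rewrite divr_gt0.
have [d1 d10 h1] := cf _ e2; have [d2 d20 h2] := cg _ e2.
exists (Num.min d1 d2); first by rewrite lt_min d10.
move=> w; rewrite lt_min => /andP[/h1 h1w /h2 h2w].
rewrite (_ : _ - _ = (f w - f z) + (g w - g z)); last by ring.
by apply: (le_lt_trans (le_normcD _ _)); lra.
Qed.

Lemma ccontZ (k : C) (f : C -> C) (z : C) :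
  ccont f z -> ccont (fun w => k * f w) z.
Proof.
move=> cf e e0; have k0 : 0 < N k + 1 by rewrite ltr_wpDl// normc_ge0.
have [d d0 h] := cf _ (divr_gt0 e0 k0); exists d => // w /h.
rewrite ltr_pdivlMr// -mulrBr normcM => /(le_lt_trans _); apply.
by rewrite mulrC ler_wpM2l ?normc_ge0// lerDl.
Qed.

Lemma rint_cst (a b c d : R) (k : C) : a <= b -> c <= d ->
  rint a b c d (fun=> k) = 0.
Proof. by move=> ab cd; rewrite /rint !cint_cst// !subrr mulr0 addr0. Qed.

(** Between opposite sides the integrand differs by the constants i(c - d) and b - a. They
    contribute i(c - d)(b - a) and i(b - a)(d - c), which cancel. *)
Lemma rint_id (a b c d : R) : a <= b -> c <= d -> rint a b c d id = 0.
Proof.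
move=> ab cd.
have [h1 h2 h3 h4] := rect_sides ab cd (fun z _ => @ccont_id z).
have cB (p q : R) (f g : R -> C) : rcont_on p q f -> rcont_on p q g ->
    cint p q f - cint p q g = cint p q (fun t => f t + -1 * g t).
  by move=> hf hg; rewrite cintD ?cintZ ?mulN1r//; exact: rcont_onZ.
rewrite /rint !cB//.
rewrite (@eq_cint _ a b _ (fun=> 'i * (c - d)%:C)); last first.
  by move=> t _; apply/eqP; rewrite eq_complex /=; apply/andP; split; apply/eqP; ring.
rewrite (@eq_cint _ c d _ (fun=> (b - a)%:C)); last first.
  by move=> t _; apply/eqP; rewrite eq_complex /=; apply/andP; split; apply/eqP; ring.
by rewrite !cint_cst// !rmorphB/=; ring.
Qed.

Lemma rint_affine (a b c d : R) (k l : C) : a <= b -> c <= d ->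
  rint a b c d (fun z => k + l * z) = 0.
Proof.
move=> ab cd.
have h2 z : onrect a b c d z -> ccont (fun w => l * w) z.
  by move=> _; apply: ccontZ; exact: ccont_id.
rewrite rintD//; last by move=> z _; exact: ccont_cst.
rewrite rint_cst// add0r (@rintZ _ _ _ _ l id)//; last by move=> z _; exact: ccont_id.
by rewrite rint_id// mulr0.
Qed.

Lemma rint_quarter (x y u v E : R) (f : C -> C) : 0 <= u -> 0 <= v ->
  (forall z, inrect x (x + u + u) y (y + v + v) z -> ccont f z) ->
  N (rint x (x + u) y (y + v) f) <= E ->
  N (rint (x + u) (x + u + u) y (y + v) f) <= E ->
  N (rint x (x + u) (y + v) (y + v + v) f) <= E ->
  N (rint (x + u) (x + u + u) (y + v) (y + v + v) f) <= E ->
  N (rint x (x + u + u) y (y + v + v) f) <= E + E + E + E.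
Proof.
move=> u0 v0 cf P1 P2 P3 P4.
have xu : x <= x + u by rewrite lerDl.
have xuu : x + u <= x + u + u by rewrite lerDl.
have yv : y <= y + v by rewrite lerDl.
have yvv : y + v <= y + v + v by rewrite lerDl.
rewrite (@rint_splitx x (x + u)) ?xu ?xuu//; last exact: le_trans yvv.
rewrite !(@rint_splity _ _ y (y + v) (y + v + v)) ?yv ?yvv//.
- rewrite -(addrA (E + E)); apply: (le_trans (le_normcD _ _)).
  by rewrite lerD// (le_trans (le_normcD _ _))// lerD.
- move=> z /andP[/andP[h1 h2] h3]; apply: cf.
  by rewrite /inrect h3 h2 (le_trans xu).
- move=> z /andP[/andP[h1 h2] h3]; apply: cf.
  by rewrite /inrect h3 h1 (le_trans h2).
Qed.

(** Subtracting the affine Taylor polynomial at p does not change the integral, and on the boundary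
    the remainder is small compared with |z - p|, which is at most u + v. A second factor u + v
    comes from the length of the contour. *)
Lemma goursat_local (f : C -> C) (p : C) (e : R) : derivable f p 1 -> 0 < e ->
  exists2 dl : R, 0 < dl & forall x y u v : R, 0 <= u -> 0 <= v -> u + v < dl ->
    inrect x (x + u) y (y + v) p ->
    (forall z, inrect x (x + u) y (y + v) z -> ccont f z) ->
    N (rint x (x + u) y (y + v) f) <= e * (u + v) ^+ 2.
Proof.
move=> /derivableP/is_derive_normcP dp e0.
(* The 4 compensates the constant of [rint_bound]. *)
have [dl dl0 hdl] := dp (e / 4) ltac:(by rewrite divr_gt0).
exists dl => // x y u v u0 v0 uv /andP[/andP[p1 p2] /andP[p3 p4]] cf.
have xu : x <= x + u by rewrite lerDl.
have yv : y <= y + v by rewrite lerDl.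
set l := 'D_1 f _ in hdl.
pose k : C := f p - l * p.
pose aff (z : C) : C := k + l * z.
have caff z : ccont aff z.
  by apply: ccontD; [exact: ccont_cst|apply: ccontZ; exact: ccont_id].
pose g (z : C) : C := f z + -1 * aff z.
have gE : rint x (x + u) y (y + v) f = rint x (x + u) y (y + v) g.
  rewrite rintD//; last 2 first.
  - by move=> z /andP[/cf].
  - by move=> z _; exact: ccontZ.
  by rewrite (rintZ _ xu yv) ?rint_affine ?mulr0 ?addr0.
have cg z : onrect x (x + u) y (y + v) z -> ccont g z.
  by move=> /andP[/cf h _]; apply: ccontD => //; exact: ccontZ.
rewrite gE; apply: (le_trans (rint_bound xu yv cg (M := e / 4 * (u + v)) _)).
  move=> z /andP[/andP[/andP[z1 z2] /andP[z3 z4]] _].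
  have zn : N (z - p) <= u + v.
    apply: (le_trans (normc_le_ReIm _)); rewrite ReB ImB.
    by apply: lerD; rewrite ler_norml; apply/andP; split; lra.
  have -> : g z = f z - f p - l * (z - p) by rewrite /g /aff /k; ring.
  apply: (le_trans (hdl _ _)); first exact: le_lt_trans uv.
  by rewrite ler_wpM2l// divr_ge0// ltW.
by rewrite le_eqVlt; apply/orP; left; apply/eqP; field.
Qed.

Theorem goursat (a b c d : R) (f : C -> C) : a <= b -> c <= d ->
  (forall z, inrect a b c d z -> derivable f z 1) -> rint a b c d f = 0.
Proof.
move=> ab cd df.
have cf z : inrect a b c d z -> ccont f z by move=> /df; exact: derivable_ccont.
set w := b - a; set h := d - c.
have w0 : 0 <= w by rewrite subr_ge0.
have h0 : 0 <= h by rewrite subr_ge0.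
have bE : b = a + w by rewrite addrC subrK.
have dE : d = c + h by rewrite addrC subrK.
apply: eq0_normc; apply/eqP; rewrite eq_le normc_ge0 andbT.
apply/ler_addgt0Pr => e e0; rewrite add0r.
(* The bound e / 4^n is chosen to add up over four quarters; containment in the given rectangle is
   made a premise of [P], so that cells outside it hold trivially. *)
pose P n x y := a <= x -> x + w / 2 ^+ n <= b -> c <= y -> y + h / 2 ^+ n <= d ->
  N (rint x (x + w / 2 ^+ n) y (y + h / 2 ^+ n) f) <= e / 4 ^+ n.
suff : P 0%N a c by rewrite /P expr0 !divr1 -bE -dE; apply.
have pos (t : R) n : 0 <= t -> 0 <= t / 2 ^+ n.
  by move=> t0; rewrite divr_ge0// exprn_ge0.
apply: (@quarter_ind _ P w h) => //.
  move=> n x y P1 P2 P3 P4; rewrite /P !(half_pow _ n) => ax xb cy yd.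
  have -> : e / 4 ^+ n =
      e / 4 ^+ n.+1 + e / 4 ^+ n.+1 + e / 4 ^+ n.+1 + e / 4 ^+ n.+1.
    by rewrite exprS; field; rewrite expf_neq0// pnatr_eq0.
  have := pos w n.+1 w0; have := pos h n.+1 h0.
  move: P1 P2 P3 P4 xb yd; rewrite /P.
  move: (w / _) (h / _) (e / _) => u v E P1 P2 P3 P4; rewrite !addrA.
  move=> xb yd v0 u0.
  have xb' : x + u <= b by apply: le_trans xb; rewrite lerDl.
  have ax' : a <= x + u by rewrite (le_trans ax)// lerDl.
  have yd' : y + v <= d by apply: le_trans yd; rewrite lerDl.
  have cy' : c <= y + v by rewrite (le_trans cy)// lerDl.
  apply: rint_quarter => //.
  - move=> z /andP[/andP[z1 z2] /andP[z3 z4]]; apply: cf.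
    by rewrite /inrect (le_trans ax)// (le_trans z2)// (le_trans cy)// (le_trans z4).
  - exact: P1.
  - exact: P2.
  - exact: P3.
  - exact: P4.
move=> p q hp hq.
have inp : inrect a b c d (p +i* q) by rewrite /inrect /= bE dE hp.
(* The summand 1 keeps k positive for a degenerate rectangle; with tolerance e / k^2 a cell of
   half-perimeter at most k / 2^n gets the bound e / 4^n. *)
set k := w + h + 1.
have k0 : 0 < k by rewrite /k ltr_wpDl// addr_ge0.
have [||dl dl0 hdl] := @goursat_local f (p +i* q) (e / k ^+ 2).
- exact: df.
- by rewrite divr_gt0// exprn_gt0.
have [n0 hn0] := half_pow_lt k0 dl0.
exists n0 => n x y /hn0 hn ax xb cy yd hx hy _ _ _ _.
have wk : w / 2 ^+ n + h / 2 ^+ n <= k / 2 ^+ n.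
  by rewrite -mulrDl ler_wpM2r ?invr_ge0 ?exprn_ge0// lerDl.
apply: (le_trans (hdl _ _ _ _ _ _ _ _ _)).
- exact: pos.
- exact: pos.
- exact: le_lt_trans hn.
- by rewrite /inrect /= hx hy.
- move=> z /andP[/andP[z1 z2] /andP[z3 z4]]; apply: cf.
  rewrite bE dE /inrect (le_trans ax)// (le_trans z2)// (le_trans cy)//.
  by rewrite (le_trans z4).
apply: (@le_trans _ _ (e / k ^+ 2 * (k / 2 ^+ n) ^+ 2)).
  rewrite ler_wpM2l ?divr_ge0 ?exprn_ge0// ?(ltW e0)// ?(ltW k0)//.
  by rewrite lerXn2r// nnegrE; [rewrite addr_ge0// pos|rewrite pos// ltW].
rewrite expr_div_n -exprM mulnC exprM (_ : 2 ^+ 2 = 4 :> R); last by rewrite -natrX.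
by rewrite mulrA divfK// expf_neq0// gt_eqF.
Qed.

End Rectangle.

(** * Derivatives of holomorphic functions *)

Section CauchyKernel.
Variable R : realType.
Local Notation C := (Cx R).
Local Notation N := (@normc R).
Local Notation Re := (@complex.Re R).
Local Notation Im := (@complex.Im R).

(** Cutting off four strips that miss w leaves a square around w as small as desired, on which f is
    bounded by continuity, so its contour integral is arbitrarily small. *)
Lemma goursat_puncture (a b c d : R) (f : C -> C) (w : C) :
  a < Re w < b -> c < Im w < d ->
  (forall z, inrect a b c d z -> z != w -> derivable f z 1) -> ccont f w ->
  rint a b c d f = 0.
Proof.
move=> /andP[aw wb] /andP[cw wd] df cfw.
have cf z : inrect a b c d z -> ccont f z.
  move=> hz; have [->//|zw] := eqVneq z w.
  by apply: derivable_ccont; exact: df.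
apply: eq0_normc; apply/eqP; rewrite eq_le normc_ge0 andbT.
apply/ler_addgt0Pr => e e0; rewrite add0r.
have [dl dl0 hdl] := cfw 1 ltr01.
pose M := N (f w) + 1.
have M0 : 0 < M by rewrite /M ltr_wpDl// normc_ge0.
have [t [t0 ta tb tc [td [tl te]]]] : exists t, [/\ 0 < t, a < Re w - t,
    Re w + t < b, c < Im w - t & Im w + t < d /\ 2 * t < dl /\ 16 * M * t <= e].
  pose m := Num.min (Num.min (Num.min (Re w - a) (b - Re w))
    (Num.min (Im w - c) (d - Im w))) (Num.min (dl / 2) (e / (8 * M))).
  have m0 : 0 < m.
    by rewrite !lt_min !subr_gt0 aw wb cw wd !divr_gt0// mulr_gt0.
  (* The square has half-side t = m / 2: halving turns the inequalities for m into strict ones, and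
     4 M (2 t + 2 t) = 16 M t is the value of [rint_bound]. *)
  have : m <= m by [].
  rewrite {2}/m !le_min => /andP[/andP[/andP[h1 h2] /andP[h3 h4]] /andP[h5]].
  rewrite ler_pdivlMr ?mulr_gt0// => h6; clearbody m.
  by exists (m / 2); split; [| | | |split; [|split]]; lra.
rewrite (@rint_splitx _ a (Re w - t)) //; last 2 first.
- by apply/andP; split; lra.
- by lra.
(* The four alternatives are the strips to the left of, to the right of, below and above the small
   square. *)
have G x1 x2 y1 y2 : a <= x1 -> x1 <= x2 -> x2 <= b -> c <= y1 -> y1 <= y2 ->
    y2 <= d -> (x2 < Re w \/ Re w < x1 \/ y2 < Im w \/ Im w < y1) ->
    rint x1 x2 y1 y2 f = 0.
  move=> h1 h2 h3 h4 h5 h6 h7; apply: goursat => // z.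
  move=> /andP[/andP[z1 z2] /andP[z3 z4]]; apply: df.
    by rewrite /inrect (le_trans h1)// (le_trans z2)// (le_trans h4)// (le_trans z4).
  by apply/eqP => zw; subst z; lra.
have sub x1 x2 y1 y2 : a <= x1 -> x2 <= b -> c <= y1 -> y2 <= d ->
    forall z, inrect x1 x2 y1 y2 z -> ccont f z.
  move=> h1 h2 h3 h4 z /andP[/andP[z1 z2] /andP[z3 z4]]; apply: cf.
  by rewrite /inrect (le_trans h1)// (le_trans z2)// (le_trans h3)// (le_trans z4).
have cd : c <= d by lra.
have wm : Re w - t < Re w by rewrite gtrBl.
have wp : Re w < Re w + t by rewrite ltrDl.
have vm : Im w - t < Im w by rewrite gtrBl.
have vp : Im w < Im w + t by rewrite ltrDl.
have [[a1 a2] a3] := (ltW ta, ltW (lt_trans wm wp), ltW tb).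
have [[c1 c2] c3] := (ltW tc, ltW (lt_trans vm vp), ltW td).
have [a4 c4] := (le_trans a2 a3, le_trans c2 c3).
rewrite G ?add0r//; last by left.
rewrite (@rint_splitx _ _ (Re w + t)) ?a2//; last exact: sub.
rewrite [X in _ + X]G ?addr0 ?(le_trans a1)//; last by right; left.
rewrite (@rint_splity _ _ _ _ (Im w - t)) ?c1 ?(le_trans c2)//; last exact: sub.
rewrite G ?add0r//; last by right; right; left.
rewrite (@rint_splity _ _ _ _ (Im w + t)) ?c2//; last exact: sub.
rewrite [X in _ + X]G ?addr0 ?(le_trans c1)//; last by right; right; right.
apply: (le_trans (@rint_bound _ _ _ _ _ M _ _ _ _ _)) => //.
- by move=> z /andP[h _]; apply: sub h.
- move=> z /andP[/andP[/andP[z1 z2] /andP[z3 z4]] _].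
  have : N (z - w) < dl.
    apply: (le_lt_trans (normc_le_ReIm _)); apply: le_lt_trans tl.
    rewrite ReB ImB mulr_natl mulr2n.
    by apply: lerD; rewrite ler_norml; apply/andP; split; lra.
  move=> /hdl/ltW h; rewrite -(subrK (f w) (f z)).
  by apply: (le_trans (le_normcD _ _)); rewrite addrC lerD2l.
by apply: le_trans te; rewrite le_eqVlt; apply/orP; left; apply/eqP; ring.
Qed.

Lemma onrect_bounded (a b c d : R) (f : C -> C) : a <= b -> c <= d ->
  (forall z, onrect a b c d z -> ccont f z) ->
  exists2 M : R, 0 < M & forall z, onrect a b c d z -> N (f z) <= M.
Proof.
move=> ab cd /(rect_sides ab cd)[f1 f2 f3 f4].
have [M1 p1 h1] := rcont_bounded ab f1; have [M2 p2 h2] := rcont_bounded ab f2.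
have [M3 p3 h3] := rcont_bounded cd f3; have [M4 p4 h4] := rcont_bounded cd f4.
exists (M1 + M2 + M3 + M4); first by rewrite !addr_gt0.
move=> [x y] /andP[/andP[/= hx hy]] /or4P[] /eqP e.
- by have := h4 _ hy; rewrite -e; lra.
- by have := h3 _ hy; rewrite -e; lra.
- by have := h1 _ hx; rewrite -e; lra.
- by have := h2 _ hx; rewrite -e; lra.
Qed.

(** Differentiation under the integral sign, reduced to a second-order estimate of the kernel that
    is uniform along the contour. Arbitrary [k] and [k1] let it serve for the first and the second
    derivative. *)
Lemma is_derive_rint_kernel (a b c d dl B : R) (f k k1 : C -> C) (w : C) :
  a <= b -> c <= d -> 0 < dl -> 0 <= B ->
  (forall z, onrect a b c d z -> ccont f z) ->
  (forall z v, onrect a b c d z -> N (v - w) < dl ->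
     ccont (fun z => f z * k (z - v)) z) ->
  (forall z, onrect a b c d z -> ccont (fun z => f z * k1 (z - w)) z) ->
  (forall z v, onrect a b c d z -> N (v - w) < dl ->
     N (k (z - v) - k (z - w) - (v - w) * k1 (z - w)) <= B * N (v - w) ^+ 2) ->
  is_derive w (1 : C) (fun v => rint a b c d (fun z => f z * k (z - v)))
    (rint a b c d (fun z => f z * k1 (z - w))).
Proof.
move=> ab cd dl0 B0 cf ck ck1 kB.
have [M M0 hM] := onrect_bounded ab cd cf.
apply/is_derive_normcP => e e0.
pose K := 4 * (M * B) * ((b - a) + (d - c)) + 1.
have K0 : 0 < K.
  by rewrite /K ltr_wpDl// !mulr_ge0// ?(ltW M0)// addr_ge0// subr_ge0.
exists (Num.min dl (e / K)); first by rewrite lt_min dl0 divr_gt0.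
move=> v; rewrite lt_min ltr_pdivlMr// => /andP[vdl ve].
have cv z : onrect a b c d z -> ccont (fun z => f z * k (z - v)) z by move=> /ck; apply.
have cw z : onrect a b c d z -> ccont (fun z => f z * k (z - w)) z.
  by move=> /ck; apply; rewrite subrr normc0.
have cZ h (g : C -> C) : (forall z, onrect a b c d z -> ccont g z) ->
    forall z, onrect a b c d z -> ccont (fun z => h * g z) z.
  by move=> cg z /cg; exact: ccontZ.
rewrite [X in N X](_ : _ =
    rint a b c d (fun z => (f z * k (z - v) + -1 * (f z * k (z - w))) +
       - (v - w) * (f z * k1 (z - w)))); last first.
  rewrite rintD//; last 2 first.
  - by move=> z hz; apply: ccontD; [exact: cv|exact: cZ hz].
  - exact: cZ.
  rewrite rintD//; last exact: cZ.
  by rewrite !rintZ//; ring.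
apply: (le_trans (@rint_bound _ _ _ _ _ (M * (B * N (v - w) ^+ 2)) _ _ _ _ _)) => //.
- move=> z hz; apply: ccontD; last exact: cZ hz.
  by apply: ccontD; [exact: cv|exact: cZ hz].
- move=> z hz.
  rewrite (_ : _ + _ = f z * (k (z - v) - k (z - w) - (v - w) * k1 (z - w))).
    by rewrite normcM ler_pM ?normc_ge0 ?hM ?kB.
  by ring.
rewrite (_ : 4 * _ * _ = (K - 1) * N (v - w) * N (v - w)); last by rewrite /K; ring.
rewrite ler_wpM2r ?normc_ge0//; apply: ltW; apply: le_lt_trans ve.
by rewrite mulrC ler_wpM2l ?normc_ge0// gerDl lerN10.
Qed.

(** The remainder is exactly h^2 / (u^2 (u - h)), and each of its three inverse factors is at most 1
    / dl. *)
Lemma inv_taylor (u h : C) (dl : R) : 0 < dl -> dl <= N u -> dl <= N (u - h) ->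
  N ((u - h)^-1 - u^-1 - h * u^-1 ^+ 2) <= dl^-1 ^+ 3 * N h ^+ 2.
Proof.
move=> dl0 hu huh.
have u0 : u != 0 by rewrite -normc_gt0 (lt_le_trans dl0).
have uh0 : u - h != 0 by rewrite -normc_gt0 (lt_le_trans dl0).
rewrite (_ : _ - _ = u^-1 ^+ 2 * (u - h)^-1 * h ^+ 2); last first.
  by field; rewrite ?u0 ?uh0.
have U : N u^-1 <= dl^-1 by rewrite normcV lef_pV2// posrE (lt_le_trans dl0).
have V : N (u - h)^-1 <= dl^-1 by rewrite normcV lef_pV2// posrE (lt_le_trans dl0).
rewrite [N (_ * h ^+ 2)]normcM [N (_ * (u - h)^-1)]normcM !normcX ler_wpM2r ?exprn_ge0 ?normc_ge0//.
by rewrite [dl^-1 ^+ 3]exprSr ler_pM ?exprn_ge0 ?normc_ge0// lerXn2r ?nnegrE ?normc_ge0// invr_ge0 ltW.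
Qed.

(** With U = 1 / u and V = 1 / (u - h) the remainder is (2 U^3 V + U^2 V^2) h^2: three products of
    degree four, whence the factor 3. *)
Lemma inv_sqr_taylor (u h : C) (dl : R) : 0 < dl -> dl <= N u -> dl <= N (u - h) ->
  N ((u - h)^-1 ^+ 2 - u^-1 ^+ 2 - h * (2 * u^-1 ^+ 3)) <=
  3 * dl^-1 ^+ 4 * N h ^+ 2.
Proof.
move=> dl0 hu huh.
have u0 : u != 0 by rewrite -normc_gt0 (lt_le_trans dl0).
have uh0 : u - h != 0 by rewrite -normc_gt0 (lt_le_trans dl0).
have q0 : 0 <= dl^-1 by rewrite invr_ge0 ltW.
set U := u^-1; set V := (u - h)^-1.
rewrite (_ : _ - _ =
   (U ^+ 3 * V + U ^+ 3 * V + U ^+ 2 * V ^+ 2) * h ^+ 2); last first.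
  by rewrite /U /V; field; rewrite ?u0 ?uh0.
have hU : N U <= dl^-1 by rewrite normcV lef_pV2// posrE (lt_le_trans dl0).
have hV : N V <= dl^-1 by rewrite normcV lef_pV2// posrE (lt_le_trans dl0).
have P i j : (i + j = 4)%N -> N (U ^+ i * V ^+ j) <= dl^-1 ^+ 4.
  by move=> <-; rewrite normcM !normcX exprD ler_pM ?exprn_ge0 ?normc_ge0//;
    rewrite lerXn2r ?nnegrE ?normc_ge0.
rewrite [N (_ * h ^+ 2)]normcM normcX ler_wpM2r ?exprn_ge0 ?normc_ge0//.
have p1 := P 3 1 erefl; have p2 := P 2 2 erefl; rewrite expr1 in p1.
rewrite (_ : 3 * _ = dl^-1 ^+ 4 + dl^-1 ^+ 4 + dl^-1 ^+ 4); last by ring.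
apply: (le_trans (le_normcD _ _)); apply: lerD => //.
by apply: (le_trans (le_normcD _ _)); apply: lerD.
Qed.

End CauchyKernel.

(** * Derivatives of Cauchy integrals; the winding integral *)

Section DerivativeHolomorphic.
Variable R : realType.
Local Notation C := (Cx R).
Local Notation N := (@normc R).
Local Notation Re := (@complex.Re R).
Local Notation Im := (@complex.Im R).

Lemma derivable_subC (z v : C) : derivable (fun u : C => u - v) z 1.
Proof. exact: derivableB (@derivable_id _ C z 1) (@derivable_cst _ C C v z 1). Qed.

Lemma derivable_kernel (f : C -> C) (z v : C) n : derivable f z 1 -> z != v ->
  derivable (fun u => f u * (u - v)^-1 ^+ n) z 1.
Proof.
move=> df zv; have zv0 : z - v != 0 by rewrite subr_eq0.
have dV := @derivableV _ C (fun u : C => u - v) z 1 zv0 (@derivable_subC z v).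
have := derivableX (n := n) dV; rewrite exprfctE => dX.
exact: derivableM df dX.
Qed.

(** The margin is twice [dl] so that the contour stays at distance [dl] from every v within [dl] of
    w, which makes the Taylor bound of the kernel uniform. *)
Lemma is_derive_cauchy1 (a b c d dl : R) (f : C -> C) (w : C) :
  a <= b -> c <= d -> 0 < dl -> (forall z, onrect a b c d z -> derivable f z 1) ->
  (forall z, onrect a b c d z -> dl + dl <= N (z - w)) ->
  is_derive w (1 : C) (fun v => rint a b c d (fun z => f z * (z - v)^-1))
    (rint a b c d (fun z => f z * (z - w)^-1 ^+ 2)).
Proof.
move=> ab cd dl0 df far.
have far' z v : onrect a b c d z -> N (v - w) < dl -> dl <= N (z - v).
  by move=> /far h1 h2; have := normc_tri z v w; lra.
have ne z v : onrect a b c d z -> N (v - w) < dl -> z != v.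
  by move=> hz /(far' _ _ hz) h; rewrite -subr_eq0 -normc_gt0 (lt_le_trans dl0).
have w0 : N (w - w) < dl by rewrite subrr normc0.
apply: (@is_derive_rint_kernel _ _ _ _ _ dl (dl^-1 ^+ 3) f (fun u => u^-1)
  (fun u => u^-1 ^+ 2)) => //.
- by rewrite exprn_ge0// invr_ge0 ltW.
- by move=> z /df; exact: derivable_ccont.
- move=> z v hz hv; apply: derivable_ccont.
  exact: (@derivable_kernel f z v 1 (df _ hz) (ne _ _ hz hv)).
- move=> z hz; apply: derivable_ccont.
  exact: (@derivable_kernel f z w 2 (df _ hz) (ne _ _ hz w0)).
- move=> z v hz hv.
  have zvE : z - v = (z - w) - (v - w) by ring.
  rewrite zvE.
  apply: inv_taylor => //; first exact: far' w0.
  by rewrite -zvE; exact: far'.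
Qed.

Lemma is_derive_cauchy2 (a b c d dl : R) (f : C -> C) (w : C) :
  a <= b -> c <= d -> 0 < dl -> (forall z, onrect a b c d z -> derivable f z 1) ->
  (forall z, onrect a b c d z -> dl + dl <= N (z - w)) ->
  is_derive w (1 : C) (fun v => rint a b c d (fun z => f z * (z - v)^-1 ^+ 2))
    (rint a b c d (fun z => f z * (2 * (z - w)^-1 ^+ 3))).
Proof.
move=> ab cd dl0 df far.
have far' z v : onrect a b c d z -> N (v - w) < dl -> dl <= N (z - v).
  by move=> /far h1 h2; have := normc_tri z v w; lra.
have ne z v : onrect a b c d z -> N (v - w) < dl -> z != v.
  by move=> hz /(far' _ _ hz) h; rewrite -subr_eq0 -normc_gt0 (lt_le_trans dl0).
have w0 : N (w - w) < dl by rewrite subrr normc0.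
apply: (@is_derive_rint_kernel _ _ _ _ _ dl (3 * dl^-1 ^+ 4) f (fun u => u^-1 ^+ 2)
  (fun u => 2 * u^-1 ^+ 3)) => //.
- by rewrite mulr_ge0// exprn_ge0// invr_ge0 ltW.
- by move=> z /df; exact: derivable_ccont.
- move=> z v hz hv; apply: derivable_ccont.
  exact: (@derivable_kernel f z v 2 (df _ hz) (ne _ _ hz hv)).
- move=> z hz.
  rewrite (_ : (fun u => _) = fun u => 2 * (f u * (u - w)^-1 ^+ 3)); last first.
    by apply/funext => u; rewrite mulrCA.
  apply: ccontZ; apply: derivable_ccont.
  exact: (@derivable_kernel f z w 3 (df _ hz) (ne _ _ hz w0)).
- move=> z v hz hv.
  have zvE : z - v = (z - w) - (v - w) by ring.
  rewrite zvE.
  apply: inv_sqr_taylor => //; first exact: far' w0.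
  by rewrite -zvE; exact: far'.
Qed.

Lemma Im_inv (z : C) : Im z^-1 = - Im z / N z ^+ 2.
Proof. by rewrite normc_sqr; case: z => x y; rewrite mulNr. Qed.

Lemma Re_inv (z : C) : Re z^-1 = Re z / N z ^+ 2.
Proof. by rewrite normc_sqr; case: z => x y. Qed.

(* The winding integral only has to be nonzero at the centre, where each of the
   four sides contributes positively to its imaginary part. *)
Lemma rint_inv_neq0 (z0 : C) (s : R) : 0 < s ->
  rint (Re z0 - s) (Re z0 + s) (Im z0 - s) (Im z0 + s) (fun z => (z - z0)^-1) != 0.
Proof.
move=> s0.
set a := Re z0 - s; set b := Re z0 + s; set c := Im z0 - s; set d := Im z0 + s.
have ab : a <= b by rewrite /a /b; lra.
have cd : c <= d by rewrite /c /d; lra.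
have ne z : onrect a b c d z -> z != z0.
  by move=> /andP[_ /or4P[] /eqP h]; apply/eqP => e; move: h;
    rewrite e /a /b /c /d; lra.
have cf z : onrect a b c d z -> ccont (fun z => (z - z0)^-1) z.
  move=> /ne hz; apply: derivable_ccont.
  rewrite (_ : (fun z => _) = fun z => cst 1 z * (z - z0)^-1 ^+ 1); last first.
    by apply/funext => u; rewrite mul1r expr1.
  exact: (@derivable_kernel _ z z0 1 (@derivable_cst _ C C 1 z 1) hz).
have [f1 f2 f3 f4] := rect_sides ab cd cf.
have key (z : C) : onrect a b c d z -> 0 < N (z - z0) ^+ 2 <= 2 * s ^+ 2.
  move=> hz; rewrite exprn_gt0 ?normc_gt0 ?subr_eq0 ?ne//= normc_sqr ReB ImB.
  move: hz => /andP[/andP[/andP[z1 z2] /andP[z3 z4]] _].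
  have sq (x : R) : - s <= x <= s -> x ^+ 2 <= s ^+ 2.
    by rewrite -ler_norml -[x ^+ 2]real_normK ?num_real// => h;
      rewrite lerXn2r// nnegrE ltW.
  rewrite mulr_natl mulr2n lerD// sq//; move: z1 z2 z3 z4; rewrite /a /b /c /d; lra.
(* No boundary point is farther from the centre than a corner, at squared distance 2 s^2. Integrated
   over a side of length 2 s, this lower bound contributes at least 1. *)
have side (z : C) : onrect a b c d z -> (2 * s)^-1 <= s / N (z - z0) ^+ 2.
  move=> /key/andP[n0 n1]; rewrite ler_pdivlMr// mulrC ler_pdivrMr ?mulr_gt0//.
  by rewrite (_ : s * (2 * s) = 2 * s ^+ 2); [|ring].
have m0 : 0 < (2 * s)^-1 * (s + s) by rewrite mulr_gt0 ?invr_gt0 ?mulr_gt0 ?addr_gt0.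
have ba : b - a = s + s by rewrite /a /b; ring.
have dc : d - c = s + s by rewrite /c /d; ring.
(* Factors i and signs are moved inside the integrals so that [Im_cint_ge] applies to each side. *)
have Nb : 'i * (cint c d (fun y => (b +i* y - z0)^-1) -
    cint c d (fun y => (a +i* y - z0)^-1)) =
   cint c d (fun y => 'i * (b +i* y - z0)^-1) +
    cint c d (fun y => - 'i * (a +i* y - z0)^-1).
  by rewrite !cintZ//; ring.
have Nt : - cint a b (fun x => (x +i* d - z0)^-1) =
    cint a b (fun x => -1 * (x +i* d - z0)^-1) by rewrite cintZ// mulN1r.
rewrite /rint Nt Nb; apply/eqP => /(congr1 Im).
rewrite !ImD (_ : Im 0 = 0)// => e0.
have h1 : (2 * s)^-1 * (b - a) <= Im (cint a b (fun x => (x +i* c - z0)^-1)).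
  apply: Im_cint_ge => // t ht; rewrite Im_inv ImB /=.
  rewrite (_ : - (c - Im z0) = s); last by rewrite /c; ring.
  by apply: side; rewrite /onrect /inrect /= ht lexx cd eqxx !orbT.
have h2 : (2 * s)^-1 * (b - a) <= Im (cint a b (fun x => -1 * (x +i* d - z0)^-1)).
  apply: Im_cint_ge => //; first exact: rcont_onZ.
  move=> t ht; rewrite mulN1r raddfN/= Im_inv ImB /= -mulNr opprK.
  rewrite (_ : d - Im z0 = s); last by rewrite /d; ring.
  by apply: side; rewrite /onrect /inrect /= ht lexx cd eqxx !orbT.
have h3 : (2 * s)^-1 * (d - c) <= Im (cint c d (fun y => 'i * (b +i* y - z0)^-1)).
  apply: Im_cint_ge => //; first exact: rcont_onZ.
  move=> t ht; rewrite ImM /= mul0r mul1r add0r Re_inv ReB /=.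
  rewrite (_ : b - Re z0 = s); last by rewrite /b; ring.
  by apply: side; rewrite /onrect /inrect /= ht lexx ab eqxx !orbT.
have h4 : (2 * s)^-1 * (d - c) <= Im (cint c d (fun y => - 'i * (a +i* y - z0)^-1)).
  apply: Im_cint_ge => //; first exact: rcont_onZ.
  move=> t ht; rewrite ImM /= oppr0 mul0r mulN1r add0r Re_inv ReB /= -mulNr.
  rewrite (_ : - (a - Re z0) = s); last by rewrite /a; ring.
  by apply: side; rewrite /onrect /inrect /= ht lexx ab eqxx.
move: m0 e0 h1 h2 h3 h4; rewrite ba dc.
move: (Im _) (Im _) (Im _) (Im _) => x1 x2 x3 x4; lra.
Qed.

End DerivativeHolomorphic.

(** * Cauchy's formula and the differentiability of the derivative *)

Section DeriveDerivable.
Variable R : realType.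
Local Notation C := (Cx R).
Local Notation N := (@normc R).
Local Notation Re := (@complex.Re R).
Local Notation Im := (@complex.Im R).

Lemma near_ball (z0 w : C) (r : R) (P : C -> Prop) : N (w - z0) < r ->
  (forall z, N (z - z0) < r -> P z) -> \forall z \near w, P z.
Proof.
move=> hw h; apply/nbhs_normcP; exists (r - N (w - z0)); first by rewrite subr_gt0.
by move=> z hz; apply: h; have := normc_tri z w z0; lra.
Qed.

(** The difference quotient of f at w, completed by the derivative, is continuous at w and
    holomorphic elsewhere, so its contour integral vanishes. The factor 1 on the right makes that
    side a Cauchy integral of a constant function. *)
Lemma cauchy_formula (f : C -> C) (a b c d : R) (w : C) :
  a < Re w < b -> c < Im w < d -> (forall z, inrect a b c d z -> derivable f z 1) ->
  rint a b c d (fun z => f z * (z - w)^-1) =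
  f w * rint a b c d (fun z => 1 * (z - w)^-1).
Proof.
move=> hx hy df; have /andP[aw wb] := hx; have /andP[cw wd] := hy.
have ab : a <= b by apply: ltW; apply: lt_trans wb.
have cd : c <= d by apply: ltW; apply: lt_trans wd.
have hw : inrect a b c d w by rewrite /inrect !ltW.
have ne z : onrect a b c d z -> z != w.
  by move=> /andP[_ /or4P[] /eqP h]; apply/eqP => e; move: h; rewrite e; lra.
have c1 z : onrect a b c d z -> ccont (fun z => f z * (z - w)^-1) z.
  move=> hz; apply: derivable_ccont; have /andP[/df dz _] := hz.
  exact: (@derivable_kernel _ f z w 1 dz (ne _ hz)).
have c2 z : onrect a b c d z -> ccont (fun z => 1 * (z - w)^-1) z.
  move=> hz; apply: derivable_ccont.
  exact: (@derivable_kernel _ _ z w 1 (@derivable_cst _ C C 1 z 1) (ne _ hz)).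
pose q z := if z == w then 'D_1 f w else (f z - f w) * (z - w)^-1.
have : rint a b c d q = 0.
  apply: (@goursat_puncture _ a b c d q w) => //.
  - move=> z hz zw.
    have dfw : derivable (fun z => f z - f w) z 1.
      exact: derivableB (df _ hz) (@derivable_cst _ C C (f w) z 1).
    have dq := @derivable_kernel _ (fun z => f z - f w) z w 1 dfw zw.
    apply: near_eq_derivable dq; apply/nbhs_normcP.
    exists (N (z - w)); first by rewrite normc_gt0 subr_eq0.
    move=> u uz; rewrite /q; case: eqP => // e.
    by move: uz; rewrite e normcB ltxx.
  - have /derivableP/is_derive_normcP dw := df _ hw.
    move=> e e0; have e2 : 0 < e / 2 by rewrite divr_gt0.
    have [dl dl0 h] := dw _ e2; exists dl => // z /h hz.
    rewrite /q eqxx; have [_|zw] := eqVneq z w; first by rewrite subrr normc0.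
    have zw0 : 0 < N (z - w) by rewrite normc_gt0 subr_eq0.
    rewrite (_ : _ - _ = (f z - f w - 'D_1 f w * (z - w)) * (z - w)^-1); last first.
      by field; rewrite subr_eq0.
    rewrite normcM normcV ltr_pdivrMr//; apply: (le_lt_trans hz).
    by rewrite ltr_pM2r//; lra.
rewrite (@eq_rint _ a b c d q
  (fun z => f z * (z - w)^-1 + - f w * (1 * (z - w)^-1)))//; last first.
  by move=> z /ne /negPf zw; rewrite /q zw; ring.
rewrite rintD//; last by move=> z /c2; exact: ccontZ.
by rewrite rintZ// => /eqP; rewrite mulNr subr_eq0 => /eqP.
Qed.

Lemma derivable_derive (f : C -> C) (z0 : C) (r : R) : 0 < r ->
  (forall z, N (z - z0) < r -> derivable f z 1) ->
  derivable (fun z => 'D_1 f z) z0 (1 : C).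
Proof.
(* Points of the square of half-side s are within 2 s < r of the centre. *)
move=> r0 df; pose s := r / 4.
have s0 : 0 < s by rewrite divr_gt0.
have s4 : r = s + s + s + s by rewrite /s; field.
have B0 := rint_inv_neq0 z0 s0; move: B0.
have aE : Re z0 - s < Re z0 by rewrite gtrBl.
have bE : Re z0 < Re z0 + s by rewrite ltrDl.
have cE : Im z0 - s < Im z0 by rewrite gtrBl.
have dE : Im z0 < Im z0 + s by rewrite ltrDl.
have ab := ltW (lt_trans aE bE); have cd := ltW (lt_trans cE dE).
have dfr z : inrect (Re z0 - s) (Re z0 + s) (Im z0 - s) (Im z0 + s) z ->
    derivable f z 1.
  move=> /andP[/andP[z1 z2] /andP[z3 z4]]; apply: df.
  apply: (@le_lt_trans _ _ (s + s)); last by rewrite s4; lra.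
  apply: (le_trans (normc_le_ReIm _)); rewrite ReB ImB.
  by apply: lerD; rewrite ler_norml; apply/andP; split; lra.
have far z : onrect (Re z0 - s) (Re z0 + s) (Im z0 - s) (Im z0 + s) z ->
    s <= N (z - z0).
  have hr := Re_le_normc (z - z0); have hi := Im_le_normc (z - z0).
  rewrite ReB in hr; rewrite ImB in hi.
  move=> /andP[_ /or4P[] /eqP e]; [apply: le_trans hr|apply: le_trans hr
    |apply: le_trans hi|apply: le_trans hi]; rewrite e.
  - by rewrite addrAC subrr sub0r normrN ler_norm.
  - by rewrite addrAC subrr add0r ler_norm.
  - by rewrite addrAC subrr sub0r normrN ler_norm.
  - by rewrite addrAC subrr add0r ler_norm.
have inw w : N (w - z0) < s / 2 ->
    Re z0 - s < Re w < Re z0 + s /\ Im z0 - s < Im w < Im z0 + s.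
  move=> hw; have := Re_le_normc (w - z0); have := Im_le_normc (w - z0).
  rewrite ReB ImB => /le_lt_trans/(_ hw) hi /le_lt_trans/(_ hw) hr.
  move: hr hi; rewrite !ltr_norml => /andP[h1 h2] /andP[h3 h4].
  by split; apply/andP; split; lra.
move: ab cd dfr far inw; set a := Re z0 - s; set b := Re z0 + s.
set c := Im z0 - s; set d := Im z0 + s => ab cd dfr far inw B0.
(* Within s / 2 of the centre, the distance to the contour is still s / 2, the margin required for
   [dl] = s / 4. *)
have farw w : N (w - z0) < s / 2 ->
    forall z, onrect a b c d z -> s / 4 + s / 4 <= N (z - w).
  by move=> hw z /far hz; have := normc_tri z w z0; lra.
have s40 : 0 < s / 4 by rewrite divr_gt0.
have dfo z : onrect a b c d z -> derivable f z 1 by move=> /andP[/dfr].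
have dc1 (z : C) : onrect a b c d z -> derivable (cst 1 : C -> C) z (1 : C).
  by move=> _; exact: derivable_cst.
pose A v := rint a b c d (fun z => f z * (z - v)^-1).
pose A1 v := rint a b c d (fun z => f z * (z - v)^-1 ^+ 2).
pose A2 v := rint a b c d (fun z => f z * (2 * (z - v)^-1 ^+ 3)).
pose B v := rint a b c d (fun z => cst 1 z * (z - v)^-1).
pose B1 v := rint a b c d (fun z => cst 1 z * (z - v)^-1 ^+ 2).
pose B2 v := rint a b c d (fun z => cst 1 z * (2 * (z - v)^-1 ^+ 3)).
have dA w : N (w - z0) < s / 2 -> is_derive w (1 : C) A (A1 w).
  by move=> /farw; exact: is_derive_cauchy1.
have dA1 w : N (w - z0) < s / 2 -> is_derive w (1 : C) A1 (A2 w).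
  by move=> /farw; exact: is_derive_cauchy2.
have dB w : N (w - z0) < s / 2 -> is_derive w (1 : C) B (B1 w).
  by move=> /farw; exact: is_derive_cauchy1.
have dB1 w : N (w - z0) < s / 2 -> is_derive w (1 : C) B1 (B2 w).
  by move=> /farw; exact: is_derive_cauchy2.
have AE w : N (w - z0) < s / 2 -> A w = f w * B w.
  by move=> /inw[hx hy]; apply: cauchy_formula.
have z0s : N (z0 - z0) < s / 2 by rewrite subrr normc0 divr_gt0.
have Bz0 : B z0 != 0.
  rewrite (_ : B z0 = rint a b c d (fun z => (z - z0)^-1))//.
  by rewrite /B; congr (rint _ _ _ _ _); apply/funext => z; rewrite mul1r.
have [dB0 _] := dB _ z0s.
have [t [t0 ts Bt]] : exists t, [/\ 0 < t, t <= s / 2 &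
    forall w, N (w - z0) < t -> B w != 0].
  have Bpos : 0 < N (B z0) by rewrite normc_gt0.
  have [t t0 ht] := derivable_ccont dB0 Bpos.
  exists (Num.min t (s / 2)); split.
  - by rewrite lt_min t0 divr_gt0.
  - by rewrite ge_min lexx orbT.
  - move=> w; rewrite lt_min => /andP[/ht hw _]; apply/eqP => e.
    by move: hw; rewrite e sub0r normcN ltxx.
(* The quotient rule for A / B; every function in it has a derivative at [z0]. *)
pose G w := (A1 w * B w - A w * B1 w) * (B w)^-1 ^+ 2.
have DE w : N (w - z0) < t -> 'D_1 f w = G w.
  move=> wt; have ws := lt_le_trans wt ts.
  have [dBw vB] := dB _ ws; have [dAw vA] := dA _ ws.
  have dV := @derivableV _ C B w 1 (Bt _ wt) dBw.
  rewrite (@near_eq_derive _ C C f (A * (fun v => (B v)^-1))); last first.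
    apply: (near_ball wt) => v vt; rewrite /= mulrfctE AE ?(lt_le_trans vt)//.
    by rewrite mulfK// Bt.
  have e (x y : C) : x *: y = x * y by [].
  rewrite (deriveM dAw dV) (@deriveV _ C B w 1 (Bt _ wt) dBw) vA vB /G !e.
  by field; exact: Bt.
have : derivable G z0 1.
  have [dA0 _] := dA _ z0s; have [dA10 _] := dA1 _ z0s; have [dB10 _] := dB1 _ z0s.
  have dV := @derivableV _ C B z0 1 Bz0 dB0.
  have := derivableX (n := 2) dV; rewrite exprfctE => dV2.
  exact: derivableM (derivableB (derivableM dA10 dB0) (derivableM dA0 dB10)) dV2.
apply: near_eq_derivable; apply/nbhs_normcP; exists t => // w wt.
by rewrite DE.
Qed.

End DeriveDerivable.

(** * Linear fractional transformations *)

Section Moebius.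
Variable R : realType.
Local Notation C := (Cx R).
Local Notation N := (@normc R).
Local Notation Re := (@complex.Re R).
Local Notation Im := (@complex.Im R).

Lemma is_derive_compC (f G : C -> C) (z l m : C) :
  is_derive z (1 : C) f l -> is_derive (f z) (1 : C) G m ->
  is_derive z (1 : C) (fun w => G (f w)) (m * l).
Proof.
move=> df dG; apply/is_derive_normcP => e e0.
have l0 : 0 < N l + 1 by rewrite ltr_wpDl// normc_ge0.
have m0 : 0 < N m + 1 by rewrite ltr_wpDl// normc_ge0.
(* The errors of G and of f each take half of e. The minimum with 1 gives |f w - f z| <= (|l| + 1)
   |w - z|. *)
pose e1 := e / 2 / (N l + 1); pose e2 := Num.min 1 (e / 2 / (N m + 1)).
have e10 : 0 < e1 by rewrite !divr_gt0.
have e20 : 0 < e2 by rewrite lt_min ltr01 !divr_gt0.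
have [d1 d10 h1] := (is_derive_normcP _ _ _).1 dG _ e10.
have [d2 d20 h2] := (is_derive_normcP _ _ _).1 df _ e20.
have [d3 d30 h3] := derivable_ccont (@ex_derive _ _ _ _ _ _ _ df) d10.
exists (Num.min d2 d3); first by rewrite lt_min d20.
move=> w; rewrite lt_min => /andP[/h2 {}h2 /h3/h1 {}h1].
rewrite (_ : _ - _ = (G (f w) - G (f z) - m * (f w - f z)) +
  m * (f w - f z - l * (w - z))); last by ring.
apply: (le_trans (le_normcD _ _)); rewrite normcM.
have e21 : e2 <= 1 by rewrite ge_min lexx.
have hf : N (f w - f z) <= (N l + 1) * N (w - z).
  rewrite (_ : _ - _ = (f w - f z - l * (w - z)) + l * (w - z)); last by ring.
  apply: (le_trans (le_normcD _ _)); rewrite normcM mulrDl mul1r addrC lerD2l.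
  by apply: (le_trans h2); rewrite ler_piMl ?normc_ge0.
have eE : e = e / 2 + e / 2 by field.
rewrite [in leRHS]eE mulrDl; apply: lerD.
  apply: (le_trans h1); apply: (le_trans (ler_wpM2l (ltW e10) hf)).
  by rewrite mulrA /e1 divfK// gt_eqF.
have hm : N m * e2 <= e / 2.
  apply: (@le_trans _ _ ((N m + 1) * (e / 2 / (N m + 1)))).
    by rewrite ler_pM ?normc_ge0 ?(ltW e20) ?lerDl// ge_min lexx orbT.
  by rewrite mulrC divfK// gt_eqF.
apply: (le_trans (ler_wpM2l (normc_ge0 m) h2)).
by rewrite mulrA ler_wpM2r ?normc_ge0.
Qed.

Lemma Im_intr (k : int) : Im (k%:~R : C) = 0.
Proof. by rewrite -(rmorph_int (real_complex R)). Qed.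

Lemma Re_intr (k : int) : Re (k%:~R : C) = k%:~R.
Proof. by rewrite -(rmorph_int (real_complex R)). Qed.

Lemma det_mx2 (T : comNzRingType) (A : 'M[T]_2) :
  \det A = A i0 i0 * A i1 i1 - A i0 i1 * A i1 i0.
Proof.
rewrite (expand_det_row A i0) !big_ord_recl big_ord0 addr0.
rewrite /cofactor !det_mx11 !mxE /= expr0 mul1r expr1 mulN1r mulrN.
by congr (_ * A _ _ - A _ _ * A _ _); apply/val_inj.
Qed.

Lemma SL2Z_det (g : 'M[int]_2) : SL2Z g ->
  g i0 i0 * g i1 i1 - g i0 i1 * g i1 i0 = 1.
Proof. by rewrite /SL2Z => <-; rewrite det_mx2. Qed.

(** The imaginary part of c z + d is c Im z; if it vanishes then c = 0, so d = 0 as well,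
    contradicting determinant 1. *)
Lemma jfac_neq0 (g : 'M[int]_2) (z : C) : SL2Z g -> upperH z -> jfac g z != 0.
Proof.
move=> /SL2Z_det gdet z0; apply/eqP => j0.
have := congr1 Im j0; rewrite /jfac ImD ImM !Im_intr Re_intr mul0r !addr0 => /eqP.
rewrite (_ : Im 0 = 0)// mulf_eq0 intr_eq0 [Im z == 0]gt_eqF// orbF => /eqP c0.
move: j0; rewrite /jfac c0 mulr0z mul0r add0r => /eqP; rewrite intr_eq0 => /eqP d0.
by move: gdet; rewrite c0 d0 !mulr0 subr0.
Qed.

Lemma upperH_mact (g : 'M[int]_2) (z : C) : SL2Z g -> upperH z -> upperH (mact g z).
Proof.
move=> gS z0; have j0 := jfac_neq0 gS z0; have gd := SL2Z_det gS.
rewrite /upperH /mact -/(jfac g z).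
have -> : Im (((g i0 i0)%:~R * z + (g i0 i1)%:~R) / jfac g z) = Im z / N (jfac g z) ^+ 2.
  rewrite ImM Im_inv Re_inv /jfac !ImD !ReD !ImM !ReM !Im_intr !Re_intr.
  have {}gd := congr1 (fun k : int => k%:~R : R) gd.
  move: gd; rewrite rmorphB !rmorphM /= mulr1z => gd.
  move: (_ ^+ 2) ((g i0 i0)%:~R) ((g i0 i1)%:~R) ((g i1 i0)%:~R) ((g i1 i1)%:~R) gd.
  by move=> n2 a b c d gd; rewrite -[in RHS](mul1r (Im z)) -gd; ring.
by rewrite divr_gt0// exprn_gt0// normc_gt0.
Qed.

Lemma jfac_mul (g k : 'M[int]_2) (z : C) : SL2Z k -> upperH z ->
  jfac (g *m k) z = jfac g (mact k z) * jfac k z.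
Proof.
move=> kS zH; have := jfac_neq0 kS zH; rewrite /jfac /mact => j0.
rewrite !mxE !big_ord_recl !big_ord0 !addr0.
have -> : lift ord0 ord0 = i1 :> 'I_2 by apply/val_inj.
by rewrite -/i0 !rmorphD !rmorphM /=; field.
Qed.

Lemma mact_mul (g k : 'M[int]_2) (z : C) : SL2Z g -> SL2Z k -> upperH z ->
  mact (g *m k) z = mact g (mact k z).
Proof.
move=> gS kS zH; have := jfac_mul g kS zH; have j0 := jfac_neq0 kS zH.
have := jfac_neq0 gS (upperH_mact kS zH).
rewrite /(mact (g *m k) z) -/(jfac (g *m k) z) => j1 ->.
rewrite /(mact g _) -/(jfac g _); move: (jfac g _) j1 => j j1.
rewrite !mxE !big_ord_recl !big_ord0 !addr0.
have -> : lift ord0 ord0 = i1 :> 'I_2 by apply/val_inj.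
rewrite -/i0 !rmorphD !rmorphM /= /mact /jfac.
rewrite /jfac in j0; field.
by rewrite ?j1 ?j0.
Qed.

Lemma is_derive_mact (g : 'M[int]_2) (z : C) : SL2Z g -> upperH z ->
  is_derive z (1 : C) (mact g) ((jfac g z)^-1 ^+ 2).
Proof.
move=> gS zH; have j0 := jfac_neq0 gS zH; have gd := SL2Z_det gS.
have aff (a b : C) : is_derive z (1 : C) (fun w : C => a * w + b) a.
  apply/is_derive_normcP => e e0; exists 1 => // w _.
  rewrite (_ : _ - _ = 0); last by ring.
  by rewrite normc0 mulr_ge0 ?normc_ge0 ?ltW.
have [d1 v1] := aff (g i0 i0)%:~R (g i0 i1)%:~R.
have [d2 v2] := aff (g i1 i0)%:~R (g i1 i1)%:~R.
have d2V := @derivableV _ C _ z 1 j0 d2.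
apply: DeriveDef; first exact: derivableM d1 d2V.
have e (x y : C) : x *: y = x * y by [].
rewrite (deriveM d1 d2V) (@deriveV _ C _ z 1 j0 d2) v1 v2 !e /jfac.
move: j0; rewrite /jfac => j0.
have {}gd := congr1 (fun k : int => k%:~R : C) gd.
move: gd; rewrite rmorphB !rmorphM /= mulr1z => gd.
move: ((g i0 i0)%:~R) ((g i0 i1)%:~R) ((g i1 i0)%:~R) ((g i1 i1)%:~R) gd j0.
by move=> a b c d gd j0; rewrite -[in RHS](mulr1 (_ ^+ 2)) -gd; field.
Qed.

End Moebius.

(** * Meromorphic functions *)

Section Meromorphic.
Variable R : realType.
Local Notation C := (Cx R).
Local Notation N := (@normc R).

(** This is the function differentiated inside [mderiv]; its value 0 at a pole is a mere default. *)
Definition hval (h : C -> option C) (z : C) : C := odflt 0 (h z).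

(** A chart with a real radius and powers of an inverse, the shape to which [derivable_kernel]
    applies; [mero_repI] goes back. *)
Lemma mero_rep (h : C -> option C) (z0 : C) : meromorphicH h -> upperH z0 ->
  exists (r : R) (g : C -> C) (n : nat), [/\ 0 < r,
    forall z, N (z - z0) < r -> upperH z /\ derivable g z (1 : C),
    (0 < n)%N -> g z0 != 0 &
    forall z, N (z - z0) < r -> h z =
      if (z == z0) && (0 < n)%N then None else Some (g z * (z - z0)^-1 ^+ n)].
Proof.
move=> hm z0H; have [r [r0 [g [n [hg [gz hh]]]]]] := hm z0 z0H.
have ri : r = (complex.Re r)%:C by rewrite RRe_real// gtr0_real.
have lt z : N (z - z0) < complex.Re r -> `|z - z0| < r by rewrite ri normC_lt.
exists (complex.Re r), g, n; split.
- by rewrite -ltcR -ri.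
- by move=> z /lt /hg.
- by [].
- by move=> z /lt /hh ->; rewrite exprVn.
Qed.

Lemma mero_repI (h : C -> option C) :
  (forall z0, upperH z0 -> exists (r : R) (g : C -> C) (n : nat), [/\ 0 < r,
    forall z, N (z - z0) < r -> upperH z /\ derivable g z (1 : C),
    (0 < n)%N -> g z0 != 0 &
    forall z, N (z - z0) < r -> h z =
      if (z == z0) && (0 < n)%N then None else Some (g z * (z - z0)^-1 ^+ n)]) ->
  meromorphicH h.
Proof.
move=> H z0 /H[r [g [n [r0 hg gz hh]]]]; exists r%:C; split; first by rewrite ltcR.
exists g, n; split; [|split] => // z; rewrite normC_lt; first exact: hg.
by move=> /hh ->; rewrite exprVn.
Qed.

(** With the power n + 1 factored out, what remains is the numerator of a chart for the derivative;
    at v it takes the value - n f(v). *)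
Lemma derive_kernel (f : C -> C) (z v : C) n : derivable f z 1 -> z != v ->
  'D_1 (fun u => f u * (u - v)^-1 ^+ n) z =
  ('D_1 f z * (z - v) - n%:R * f z) * (z - v)^-1 ^+ n.+1.
Proof.
move=> df zv; have zv0 : z - v != 0 by rewrite subr_eq0.
have dS := @derivable_subC R z v.
have vS : 'D_1 (fun u : C => u - v) z = 1.
  have := deriveB (@derivable_id _ C z 1) (@derivable_cst _ C C v z 1).
  by rewrite derive_id derive_cst subr0.
have dV := @derivableV _ C (fun u : C => u - v) z 1 zv0 dS.
have dX := derivableX (n := n) dV.
have e (x y : C) : x *: y = x * y by [].
have -> : (fun u => f u * (u - v)^-1 ^+ n) = f * (fun u => (u - v)^-1) ^+ n.
  by rewrite exprfctE.
rewrite (deriveM df dX) (@deriveX _ C _ n z 1 dV).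
rewrite (@deriveV _ C (fun u : C => u - v) z 1 zv0 dS) vS !e exprfctE mulr1.
case: n {dX} => [|n] /=; first by rewrite expr0 expr1; field.
by rewrite !exprS -!natr1; field.
Qed.

(* Off the possible pole [z0] itself, the chart at [z0] exhibits [h] as a
   holomorphic function. *)
Lemma rep_regular (h : C -> option C) (z0 : C) (r : R) (g : C -> C) (n : nat) :
  (forall z, N (z - z0) < r -> upperH z /\ derivable g z (1 : C)) ->
  (forall z, N (z - z0) < r -> h z =
    if (z == z0) && (0 < n)%N then None else Some (g z * (z - z0)^-1 ^+ n)) ->
  forall z, N (z - z0) < r -> (z != z0) || (n == 0%N) ->
    [/\ h z = Some (hval h z), derivable (hval h) z 1 &
        'D_1 (hval h) z = if n == 0%N then 'D_1 g z else
          ('D_1 g z * (z - z0) - n%:R * g z) * (z - z0)^-1 ^+ n.+1].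
Proof.
move=> hg hh z zr zreg; have [_ dg] := hg z zr.
have hz : h z = Some (hval h z).
  rewrite /hval hh//; case: eqP zreg => //= _ /eqP ->; by rewrite ltnn.
suff [dh vh] : is_derive z (1 : C) (hval h) (if n == 0%N then 'D_1 g z else
    ('D_1 g z * (z - z0) - n%:R * g z) * (z - z0)^-1 ^+ n.+1).
  by split; [exact: hz|exact: dh|exact: vh].
have [n0|n0] := eqVneq n 0%N.
  apply: near_eq_is_derive (derivableP dg); apply: (near_ball zr) => w wr.
  by rewrite /hval hh// n0 ltnn andbF /= expr0 mulr1.
have zz0 : z != z0 by move: zreg; rewrite (negPf n0) orbF.
rewrite -(@derive_kernel g z z0 n dg zz0).
apply: near_eq_is_derive (derivableP (@derivable_kernel R g z z0 n dg zz0)).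
have [e e0 he] : exists2 e, 0 < e & forall w, N (w - z) < e -> w != z0.
  exists (N (z - z0)); first by rewrite normc_gt0 subr_eq0.
  by move=> w; apply: contraTneq => ->; rewrite normcB ltxx.
apply: filterS2 (near_ball zr hh) ((nbhs_normcP _ _).2 (ex_intro2 _ _ e e0 he)).
by move=> w hw /negPf wz; rewrite /hval hw wz.
Qed.

(** A finite value at the centre of a chart forces its exponent to be 0, and the chart is then
    holomorphic throughout. *)
Lemma mero_regular (h : C -> option C) (z : C) : meromorphicH h -> upperH z ->
  h z -> exists2 r : R, 0 < r & forall w, N (w - z) < r ->
    [/\ upperH w, h w = Some (hval h w) & derivable (hval h) w 1].
Proof.
move=> hm zH hz; have [r [g [n [r0 hg _ hh]]]] := mero_rep hm zH.
have n0 : n = 0%N.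
  move: hz; rewrite hh; last by rewrite subrr normc0.
  by rewrite eqxx /=; case: n {hh}.
exists r => // w wr; have [wH _] := hg _ wr.
have [|h1 h2 _] := rep_regular hg hh wr; first by rewrite n0 orbT.
by split.
Qed.

Lemma mero_punctured (h : C -> option C) (z : C) : meromorphicH h -> upperH z ->
  exists2 r : R, 0 < r & forall w, N (w - z) < r ->
    upperH w /\ (w != z -> h w = Some (hval h w)).
Proof.
move=> hm zH; have [r [g [n [r0 hg _ hh]]]] := mero_rep hm zH.
exists r => // w wr; have [wH _] := hg _ wr; split=> // wz.
by have [|-> _ _] := rep_regular hg hh wr; rewrite ?wz.
Qed.

Lemma mderivE (h : C -> option C) (z : C) :
  mderiv h z = if h z then Some ('D_1 (hval h) z) else None.
Proof. by rewrite /mderiv; case: (h z). Qed.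

Lemma meromorphic_mderiv (h : C -> option C) :
  meromorphicH h -> meromorphicH (mderiv h).
Proof.
move=> hm; apply: mero_repI => z0 z0H.
have [r [g [n [r0 hg gz hh]]]] := mero_rep hm z0H.
have dDg z : N (z - z0) < r -> derivable (fun w => 'D_1 g w) z 1.
  move=> zr; apply: (@derivable_derive _ g z (r - N (z - z0))).
    by rewrite subr_gt0.
  by move=> w wz; have [] := hg w => //; have := normc_tri w z z0; lra.
(* A regular point has to keep exponent 0, since exponent [n.+1] would declare a pole there. *)
have [n0|n0] := eqVneq n 0%N.
  exists r, (fun w => 'D_1 g w), 0%N; split; [exact: r0| |by []|].
    by move=> z zr; have [zH _] := hg z zr; split; [exact: zH|exact: dDg].
  move=> z zr; rewrite mderivE.
  have [|-> _ ->] := rep_regular hg hh zr; first by rewrite n0 orbT.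
  by rewrite andbF n0 eqxx expr0 mulr1.
exists r, (fun w => 'D_1 g w * (w - z0) - n%:R * g w), n.+1.
split; [exact: r0| | |].
- move=> z zr; have [zH dg] := hg z zr; split; first exact: zH.
  have dn : derivable (fun w => n%:R * g w) z 1.
    exact: derivableM (@derivable_cst _ C C n%:R z 1) dg.
  exact: derivableB (derivableM (dDg _ zr) (@derivable_subC R z z0)) dn.
(* At [z0] the numerator is - n g(z0), nonzero because n > 0: the pole order is exactly n + 1. *)
- move=> _; rewrite subrr mulr0 sub0r oppr_eq0 mulf_neq0 ?gz ?lt0n//.
  by rewrite pnatr_eq0.
- move=> z zr; rewrite andbT mderivE; have [zz0|zz0] := eqVneq z z0.
    by rewrite hh// zz0 eqxx lt0n n0.
  have [|-> _ ->] := rep_regular hg hh zr; first by rewrite zz0.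
  by rewrite (negPf n0).
Qed.

End Meromorphic.

(** * Functions with zero derivative *)

Section LocallyConstant.
Variable R : realType.
Local Notation C := (Cx R).
Local Notation N := (@normc R).
Local Notation Re := (@complex.Re R).
Local Notation Im := (@complex.Im R).

Lemma normc_real (t : R) : N (t%:C : C) = `|t|.
Proof. by rewrite /= expr0n/= addr0 sqrtr_sqr. Qed.

(** In place of a mean value theorem, bisection: the bound e times the length of a parameter
    interval adds up over halves and holds on short intervals because the derivative is zero. *)
Lemma derive0_segment (f : C -> C) (u v : C) :
  (forall t : R, 0 <= t <= 1 -> is_derive (u + t%:C * (v - u)) (1 : C) f 0) ->
  f u = f v.
Proof.
move=> df; pose y t : C := u + t%:C * (v - u).
have yE s t : y s - y t = (s - t)%:C * (v - u) by rewrite /y rmorphB/=; ring.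
have y0 : y 0 = u by rewrite /y rmorph0; ring.
have y1 : y 1 = v by rewrite /y rmorph1; ring.
suff H : N (f (y 1) - f (y 0)) = 0.
  by apply/esym/eqP; rewrite -subr_eq0 -y0 -y1; apply/eqP/eq0_normc.
apply/eqP; rewrite eq_le normc_ge0 andbT; apply/ler_addgt0Pr => e e0; rewrite add0r.
pose P n (s _ : R) := N (f (y (s + 1 / 2 ^+ n)) - f (y s)) <= e / 2 ^+ n.
suff : P 0%N 0 0 by rewrite /P expr0 !divr1 add0r.
apply: (@quarter_ind _ P 1 0) => //.
  move=> n s t P1 P2 _ _; rewrite /P !(half_pow _ n) addrA.
  apply: (le_trans (normc_tri _ (f (y (s + 1 / 2 ^+ n.+1))) _)).
  exact: lerD P2 P1.
move=> p q; rewrite add0r => hp _.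
have K0 : 0 < N (v - u) + 1 by rewrite ltr_wpDl// normc_ge0.
have [d d0 hd] := (is_derive_normcP _ _ _).1 (df _ hp) _ (divr_gt0 e0 K0).
have [n0 hn0] := half_pow_lt ltr01 (divr_gt0 d0 K0).
exists n0 => n s t /hn0; rewrite ltr_pdivlMr// => hn _ _ _ _ /andP[h1 h2] _.
rewrite /P; set l := 1 / 2 ^+ n in hn h2 *.
have l0 : 0 <= l by rewrite /l divr_ge0 ?exprn_ge0.
have hE : e / 2 ^+ n = e / (N (v - u) + 1) * (l * (N (v - u) + 1)).
  by rewrite /l; field; rewrite expf_neq0 ?pnatr_eq0//= gt_eqF.
have B r : `|r - p| <= l ->
    N (f (y r) - f (y p)) <= e / (N (v - u) + 1) * (`|r - p| * (N (v - u) + 1)).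
  move=> rp; have := hd (y r); rewrite -/(y p) mul0r subr0 yE normcM normc_real => H.
  have le : `|r - p| * N (v - u) <= `|r - p| * (N (v - u) + 1).
    by rewrite ler_wpM2l// lerDl.
  apply: (le_trans (H _)).
    apply: (le_lt_trans le); apply: le_lt_trans hn.
    by rewrite ler_wpM2r// ltW.
  by rewrite ler_wpM2l// divr_ge0// ltW.
have n1 : `|s + l - p| = s + l - p by rewrite ger0_norm// subr_ge0.
have n2 : `|s - p| = p - s by rewrite distrC ger0_norm// subr_ge0.
have H1 : `|s + l - p| <= l by rewrite n1 lerBlDr addrC lerD2l.
have H2 : `|s - p| <= l by rewrite n2 lerBlDr addrC.
have {H1} H1 := B _ H1; have {H2} H2 := B _ H2; rewrite n1 in H1; rewrite n2 in H2.
(* As p lies in the interval, the distances of its two ends from p add up to its length l. *)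
apply: (le_trans (normc_tri _ (f (y p)) _)); rewrite [X in _ + X]normcB hE.
rewrite (_ : _ * (l * _) = e / (N (v - u) + 1) * ((s + l - p) * (N (v - u) + 1)) +
  e / (N (v - u) + 1) * ((p - s) * (N (v - u) + 1))); last by ring.
exact: lerD.
Qed.

(** When the segment from u to v passes through z0, v lies opposite to u as seen from z0. A quarter
    turn of u about z0 then gives a point of the disc that both can reach along segments avoiding
    z0. *)
Lemma derive0_punctured_ball (f : C -> C) (z0 : C) (r : R) :
  (forall z, N (z - z0) < r -> z != z0 -> is_derive z (1 : C) f 0) ->
  forall u v, N (u - z0) < r -> N (v - z0) < r -> u != z0 -> v != z0 -> f u = f v.
Proof.
move=> df u v ur vr uz vz.
have seg p q : N (p - z0) < r -> N (q - z0) < r ->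
    (forall t : R, 0 <= t <= 1 -> p + t%:C * (q - p) != z0) -> f p = f q.
  move=> pr qr hpq; apply: derive0_segment => t t01; apply: df; last exact: hpq.
  rewrite (_ : _ - _ = (1 - t)%:C * (p - z0) + t%:C * (q - z0)); last first.
    by rewrite rmorphB rmorph1; ring.
  apply: (le_lt_trans (le_normcD _ _)); rewrite !normcM !normc_real.
  have /andP[t0 t1] := t01.
  rewrite !ger0_norm ?subr_ge0//.
  have [m mE [mp mq]] : exists2 m, m < r & N (p - z0) <= m /\ N (q - z0) <= m.
    by exists (Num.max (N (p - z0)) (N (q - z0))); rewrite ?gt_max ?pr// !le_max !lexx orbT.
  apply: le_lt_trans mE.
  rewrite (_ : m = (1 - t) * m + t * m); last by ring.
  by rewrite lerD// ler_wpM2l// subr_ge0.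
have [h|/existsNP[t /not_implyP[t01 /negP]]] :=
  pselect (forall t : R, 0 <= t <= 1 -> u + t%:C * (v - u) != z0); first exact: seg.
rewrite negbK => /eqP tz.
have x0 : u - z0 != 0 by rewrite subr_eq0.
pose w : C := z0 + 'i * (u - z0).
have wz : w - z0 = 'i * (u - z0) by rewrite /w; ring.
have wr : N (w - z0) < r.
  by rewrite wz normcM (_ : N 'i = 1) ?mul1r// /= expr0n/= add0r expr1n sqrtr1.
have tu : (1 - t)%:C * (u - z0) = - (t%:C * (v - z0)).
  by rewrite -[X in v - X]tz -[X in u - X]tz rmorphB rmorph1; ring.
have key (a b : R) : (a +i* b : C) * (u - z0) = 0 -> a = 0 /\ b = 0.
  by move=> /eqP; rewrite mulf_eq0 (negPf x0) orbF eq_complex /= => /andP[/eqP -> /eqP ->].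
transitivity (f w); apply: seg => // s s01; apply/eqP => sz.
  have /key[a0 b0] : ((1 - s) +i* s : C) * (u - z0) = 0.
    rewrite (_ : (_ +i* _ : C) = (1 - s)%:C + s%:C * 'i); last first.
      by apply/eqP; rewrite eq_complex /= ?mulr0 ?mulr1 ?mul0r ?add0r ?subr0 ?addr0 !eqxx.
    have := congr1 (fun z => z - z0) sz; rewrite subrr => <-.
    by rewrite /w rmorphB rmorph1; ring.
  by lra.
have E : t%:C * ((1 - s)%:C * ('i * (u - z0)) + s%:C * (v - z0)) = 0.
  have := congr1 (fun z => z - z0) sz; rewrite subrr => e0.
  rewrite -[RHS](mulr0 t%:C) -[in RHS]e0 -wz rmorphB rmorph1; ring.
(* Multiplying by t lets v - z0 be expressed through u - z0. The vanishing of both coordinates gives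
   s = 1 and then t = 1, which is excluded because v differs from z0. *)
have /key[a0 b0] : ((- (s * (1 - t))) +i* (t * (1 - s)) : C) * (u - z0) = 0.
  have tv : t%:C * (v - z0) = - ((1 - t)%:C * (u - z0)) by rewrite tu opprK.
  rewrite -E (_ : t%:C * (_ + _) = t%:C * ((1 - s)%:C * ('i * (u - z0))) +
    s%:C * (t%:C * (v - z0))); last by ring.
  rewrite tv (_ : (_ +i* _ : C) = - (s%:C * (1 - t)%:C) + t%:C * (1 - s)%:C * 'i).
    by ring.
  apply/eqP; rewrite eq_complex; apply/andP; split; apply/eqP => /=; ring.
have t0 : t != 0.
  apply/eqP => t0; move: tz; rewrite t0 rmorph0 mul0r addr0 => e.
  by rewrite e eqxx in uz.
have t1 : t != 1.
  apply/eqP => t1; move: tz; rewrite t1 rmorph1 mul1r addrC subrK => e.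
  by rewrite e eqxx in vz.
move: b0 => /eqP; rewrite mulf_eq0 (negPf t0) /= subr_eq0 => /eqP s1.
move: a0; rewrite -s1 mul1r opprB => /eqP; rewrite subr_eq0 => /eqP e1.
by rewrite e1 eqxx in t1.
Qed.

End LocallyConstant.

(** * Constancy on the half-plane and the two transformation laws *)

Section Equivariance.
Variable R : realType.
Local Notation C := (Cx R).
Local Notation N := (@normc R).
Local Notation Im := (@complex.Im R).

(* The exceptional set is discrete but need not be avoidable along a segment;
   passing to the function [c] of local constant values removes it. *)
Lemma derive0_upperH (k : C -> C) (reg : C -> Prop) :
  (forall z, upperH z -> exists2 r : R, 0 < r & forall w, N (w - z) < r ->
     upperH w /\ (w != z -> reg w)) ->
  (forall z, upperH z -> reg z -> is_derive z (1 : C) k 0) ->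
  exists b, forall z, upperH z -> reg z -> k z = b.
Proof.
move=> hreg dk.
have shift (z : C) (t : R) : 0 < t -> N (z + t%:C - z) = t /\ z + t%:C != z.
  move=> t0; have tn : N (z + t%:C - z) = t.
    by rewrite addrC addKr normc_real gtr0_norm.
  by split=> //; rewrite -subr_eq0 -normc_gt0 tn.
have loc z0 : exists rc : R * C, upperH z0 -> 0 < rc.1 /\
    forall w, N (w - z0) < rc.1 -> upperH w /\ (reg w -> k w = rc.2).
  have [z0H|] := pselect (upperH z0); last by exists (0, 0).
  have [r r0 hr] := hreg z0 z0H; have r20 : 0 < r / 2 by rewrite divr_gt0.
  have [ur uz] := shift z0 _ r20.
  have {}ur : N (z0 + (r / 2)%:C - z0) < r by rewrite ur ltr_pdivrMr// ltr_pMr// ltr1n.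
  have dball z : N (z - z0) < r -> z != z0 -> is_derive z (1 : C) k 0.
    by move=> /hr[zH zreg] /zreg; exact: dk.
  exists (r, k (z0 + (r / 2)%:C)) => _; split=> //= w wr.
  have [wH _] := hr w wr; split=> // wreg.
  have [wz|wz] := eqVneq w z0; last exact: (derive0_punctured_ball dball).
  (* A regular centre is joined to the base point z0 + r / 2 by a segment along which k has
     derivative zero, its starting point included. *)
  rewrite wz in wreg *; apply: derive0_segment => t /andP[t0 t1].
  rewrite (_ : _ + t%:C * _ = z0 + (t * (r / 2))%:C); last first.
    by rewrite rmorphM/=; ring.
  have [->|tn0] := eqVneq t 0; first by rewrite mul0r rmorph0 addr0; exact: dk.
  have tr0 : 0 < t * (r / 2) by rewrite mulr_gt0// lt_neqAle eq_sym tn0.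
  have [tr tz] := shift z0 _ tr0; apply: dball => //; rewrite tr.
  apply: (@le_lt_trans _ _ (r / 2)); first by rewrite ler_piMl// ltW.
  by rewrite ltr_pdivrMr// ltr_pMr// ltr1n.
have [F HF] := choice loc; pose c z := (F z).2.
have cloc z0 z1 : upperH z0 -> N (z1 - z0) < (F z0).1 -> c z1 = c z0.
  move=> z0H z1r; have [r0 h0] := HF z0 z0H; have [z1H _] := h0 _ z1r.
  have [r1 h1] := HF z1 z1H; have [s s0 hs] := hreg z1 z1H.
  (* The point z1 + t lies in both discs and in the punctured neighbourhood of z1 where all points
     are regular; there k equals both local constants. *)
  pose t := Num.min (Num.min (F z1).1 s) ((F z0).1 - N (z1 - z0)) / 2.
  have m0 : 0 < Num.min (Num.min (F z1).1 s) ((F z0).1 - N (z1 - z0)).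
    by rewrite !lt_min r1 s0 subr_gt0.
  have t0 : 0 < t by rewrite divr_gt0.
  have : t < Num.min (Num.min (F z1).1 s) ((F z0).1 - N (z1 - z0)).
    by rewrite ltr_pdivrMr// ltr_pMr// ltr1n.
  rewrite !lt_min => /andP[/andP[tF ts] tr].
  have [tn tz] := shift z1 _ t0.
  have w0 : N (z1 + t%:C - z0) < (F z0).1.
    by have := normc_tri (z1 + t%:C) z1 z0; rewrite tn; lra.
  have w1 : N (z1 + t%:C - z1) < (F z1).1 by rewrite tn.
  have ws : N (z1 + t%:C - z1) < s by rewrite tn.
  have [_ wreg] := hs _ ws; have {}wreg := wreg tz.
  have [_ e0] := h0 _ w0; have [_ e1] := h1 _ w1.
  by rewrite /c -(e0 wreg) -(e1 wreg).
(* Unlike k, the function c has derivative zero at every point of the half-plane, so segments to i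
   can be used freely. *)
have dc z : upperH z -> is_derive z (1 : C) c 0.
  move=> zH; have [r0 _] := HF z zH.
  apply/is_derive_normcP => e e0; exists (F z).1 => // w wr.
  by rewrite (cloc z w zH wr) mul0r !subrr normc0 mulr_ge0 ?normc_ge0 ?ltW.
have iH : upperH ('i : C) by rewrite /upperH /= ltr01.
exists (c 'i) => z zH zreg.
have [r0 h0] := HF z zH; have [_ ->//] : upperH z /\ (reg z -> k z = c z).
  by apply: h0; rewrite subrr normc0.
apply: derive0_segment => t /andP[t0 t1]; apply: dc.
move: zH iH; rewrite /upperH ImD ImM ImB /= mul0r addr0 => z0 _.
rewrite (_ : _ + _ = (1 - t) * Im z + t); last by ring.
have [->|tn1] := eqVneq t 1; first by rewrite subrr mul0r add0r ltr01.
by rewrite ltr_wpDr// mulr_gt0// subr_gt0 lt_neqAle tn1.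
Qed.

Lemma mderiv_equivariance (h : C -> option C) (g : 'M[int]_2) (x : C) :
  meromorphicH h -> SL2Z g ->
  (forall z, upperH z ->
     mderiv h (mact g z) = omap (fun w => x * jfac g z ^+ 2 * w) (mderiv h z)) ->
  exists b, forall z, upperH z -> h z -> hval h (mact g z) = x * hval h z + b.
Proof.
move=> hm gS hmod.
pose k := (fun z => hval h (mact g z)) - x *: hval h.
have dk z : upperH z -> h z -> is_derive z (1 : C) k 0.
  move=> zH hz; have j0 := jfac_neq0 gS zH.
  have gzH := upperH_mact gS zH.
  have := hmod z zH; rewrite !mderivE hz /=.
  (* [mderiv h] is [None] exactly where [h] is, so the law at z excludes a pole at g z. *)
  case hgz : (h (mact g z)) => [v|] //= [hD].
  have hgzs : h (mact g z) by rewrite hgz.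
  have [r r0 /(_ z)] := mero_regular hm zH hz.
  rewrite subrr normc0 => /(_ r0)[_ _ dz].
  have [r1 r10 /(_ (mact g z))] := mero_regular hm gzH hgzs.
  rewrite subrr normc0 => /(_ r10)[_ _ dgz].
  have d1 := is_derive_compC (is_derive_mact gS zH) (derivableP dgz).
  have d2 := is_deriveZ x (derivableP dz).
  have d12 := is_deriveB d1 d2; rewrite hD in d12.
  apply: is_derive_eq d12 _.
  have e (y w : C) : y *: w = y * w by [].
  by rewrite e; field.
have [|b hb] := @derive0_upperH k h _ dk.
  move=> z zH; have [r r0 hr] := mero_punctured hm zH.
  by exists r => // w /hr[wH hw]; split=> // /hw ->.
exists b => z zH hz; rewrite -(hb z zH hz) /k.
by rewrite -[(_ - _) z]/(hval h (mact g z) - x * hval h z) addrC subrK.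
Qed.

Lemma equivariance_mderiv (h : C -> option C) (g : 'M[int]_2) (M : 'M[C]_2) :
  meromorphicH h -> SL2Z g -> M i1 i0 = 0 -> M i1 i1 != 0 ->
  (forall z, upperH z -> h (mact g z) = msph M (h z)) ->
  forall z, upperH z -> mderiv h (mact g z) =
    omap (fun w => M i0 i0 / M i1 i1 * jfac g z ^+ 2 * w) (mderiv h z).
Proof.
move=> hm gS M0 M1 heq z zH; have gzH := upperH_mact gS zH.
have hE v : msph M (Some v) = Some ((M i0 i0 * v + M i0 i1) / M i1 i1).
  by rewrite /msph M0 mul0r add0r (negPf M1).
(* At a pole of h both sides are [None], since a triangular matrix fixes infinity. *)
rewrite !mderivE heq//; case hz : (h z) => [v|]; last by rewrite /= M0 eqxx.
rewrite hE /=; congr Some.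
have hzs : h z by rewrite hz.
have hgz : h (mact g z) by rewrite heq// hz hE.
have [r r0 hr] := mero_regular hm zH hzs.
have [_ _ dz] : [/\ upperH z, h z = Some (hval h z) & derivable (hval h) z 1].
  by apply: hr; rewrite subrr normc0.
have [r1 r10 /(_ (mact g z))] := mero_regular hm gzH hgz.
rewrite subrr normc0 => /(_ r10)[_ _ dgz].
have d1 := is_derive_compC (is_derive_mact gS zH) (derivableP dgz).
have d2 := is_deriveZ (M i0 i0 / M i1 i1) (derivableP dz).
have d3 := is_deriveD d2 (@is_derive_cst _ C C (M i0 i1 / M i1 i1) z 1).
(* The identity is claimed only near z, where h stays finite; at a pole the default value of [hval]
   could violate it. *)
have E : \forall w \near z, (fun w => hval h (mact g w)) w =
    ((M i0 i0 / M i1 i1) *: hval h + cst (M i0 i1 / M i1 i1)) w.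
  apply: (near_ball _ (_ : forall w, N (w - z) < r -> _)); first by rewrite subrr normc0.
  move=> w /hr[wH hw _]; rewrite {1}/hval heq// hw hE /=.
  rewrite -[RHS]/(M i0 i0 / M i1 i1 * hval h w + M i0 i1 / M i1 i1).
  by field.
have [_ v1] := d1; have [_ v3] := d3.
have := @near_eq_derive _ C C _ _ z 1 E; rewrite v1 v3 addr0 => D.
have j0 := jfac_neq0 gS zH.
have e (y w : C) : y *: w = y * w by [].
rewrite e in D; rewrite mulrAC -D; field; exact: j0.
Qed.

(** Provides the point at which the cocycle identity is read off: poles are isolated, so some point
    close to i will do. *)
Lemma mero_regular_point (h : C -> option C) : meromorphicH h ->
  exists2 z, upperH z & h z.
Proof.
move=> hm; have iH : upperH ('i : C) by rewrite /upperH /= ltr01.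
have [r r0 hr] := mero_punctured hm iH.
have wN : N ('i + (r / 2)%:C - 'i) = r / 2.
  by rewrite addrC addKr normc_real gtr0_norm// divr_gt0.
have wr : N ('i + (r / 2)%:C - 'i) < r by rewrite wN ltr_pdivrMr// ltr_pMr// ltr1n.
have [wH hw] := hr _ wr; exists ('i + (r / 2)%:C) => //.
by rewrite hw// -subr_eq0 -normc_gt0 wN divr_gt0.
Qed.

End Equivariance.

Local Close Scope complex_scope.

(** * Triangular representations and characters *)

Theorem theorem4p3 (R : realType) (h : Cx R -> option (Cx R))
  (Gam : 'M[int]_2 -> Prop) :
  meromorphicH h -> fin_index_subgroup Gam ->
  ((exists rho : 'M[int]_2 -> 'M[Cx R]_2,
       is_repr Gam rho /\ triangular_repr Gam rho /\ equivariant Gam rho h)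
   <->
   (exists chi : 'M[int]_2 -> Cx R,
       is_character Gam chi /\ mero_modform2 Gam chi (mderiv h))).
Proof.
move=> hm [GS [_ [GM _]]].
have mulE (A B : 'M[Cx R]_2) i j : (A *m B) i j = A i i0 * B i0 j + A i i1 * B i1 j.
  rewrite !mxE !big_ord_recl !big_ord0 addr0.
  by congr (_ + A i _ * B _ j); apply/val_inj.
split.
  move=> [rho [[rU rM] [rT rE]]].
  (* In rho(g) V = 1, with diagonal entries a and d of rho(g), the bottom row gives d V11 = 1 and d
     V10 = 0. Hence V10 = 0, and the top left entry reduces to a V00 = 1. *)
  have r1 g : Gam g -> rho g i0 i0 != 0 /\ rho g i1 i1 != 0.
    move=> Gg; have := congr1 (fun A : 'M[Cx R]_(2, 2) => A i0 i0) (mulmxV (rU g Gg)).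
    have := congr1 (fun A : 'M[Cx R]_(2, 2) => A i1 i1) (mulmxV (rU g Gg)).
    have := congr1 (fun A : 'M[Cx R]_(2, 2) => A i1 i0) (mulmxV (rU g Gg)).
    rewrite !mulE !(rT g Gg) !mul0r !add0r !mxE /=.
    move: (invmx _) => V e10 e11 e00.
    have d0 : rho g i1 i1 != 0.
      by apply: contra_eq_neq e11 => ->; rewrite mul0r eq_sym oner_neq0.
    split=> //; move/eqP: e10; rewrite mulf_eq0 (negPf d0) /= => /eqP V10.
    move: e00; rewrite V10 mulr0 addr0; apply: contra_eq_neq => ->.
    by rewrite mul0r eq_sym oner_neq0.
  exists (fun g => rho g i0 i0 / rho g i1 i1); split; [split|split].
  - by move=> g /r1[a0 d0]; rewrite mulf_neq0 ?invr_eq0.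
  - move=> g k Gg Gk; rewrite rM// !mulE (rT g Gg) (rT k Gk) mulr0 mul0r addr0 add0r.
    have [_ d0] := r1 g Gg; have [_ d1] := r1 k Gk.
    by field; rewrite ?d0 ?d1.
  - exact: meromorphic_mderiv.
  - move=> g z Gg zH; have [_ d0] := r1 g Gg.
    apply: equivariance_mderiv => //; [exact: GS|exact: rT|].
    by move=> w wH; exact: rE.
move=> [chi [[c0 cM] [_ cE]]].
have /choice[b hb] : forall g, exists b, Gam g -> forall z, upperH z -> h z ->
    hval h (mact g z) = chi g * hval h z + b.
  move=> g; have [Gg|] := pselect (Gam g); last by exists 0.
  have [b hb] := mderiv_equivariance hm (GS g Gg) (fun z zH => cE g z Gg zH).
  by exists b.
(* The law for [mderiv h] equates its [None] values at z and g z, and these are the poles of h. *)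
have hN g z : Gam g -> upperH z -> h (mact g z) = h z :> bool.
  move=> Gg zH; have := cE g z Gg zH; rewrite !mderivE.
  by case: (h (mact g z)) (h z) => [?|] [?|].
have hS z : h z -> h z = Some (hval h z) by rewrite /hval; case: (h z).
pose rho g : 'M[Cx R]_2 := \matrix_(i, j)
  if i == i0 then if j == i0 then chi g else b g else (j == i1)%:R.
have r00 g : rho g i0 i0 = chi g by rewrite mxE.
have r01 g : rho g i0 i1 = b g by rewrite mxE.
have r10 g : rho g i1 i0 = 0 by rewrite mxE.
have r11 g : rho g i1 i1 = 1 by rewrite mxE.
exists rho; split; [split|split].
- move=> g Gg; rewrite unitmxE det_mx2 r00 r01 r10 r11 mulr1 mulr0 subr0 unitfE.
  exact: c0.
- move=> g k Gg Gk; have [z zH hz] := mero_regular_point hm.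
  have Ggk := GM _ _ Gg Gk.
  have kzH := upperH_mact (GS k Gk) zH.
  have hkz : h (mact k z) by rewrite hN.
  (* Both expressions for h(g k z) are compared at one z where h is finite; h is then finite at k z
     too. *)
  have bM : b (g *m k) = chi g * b k + b g.
    have := hb _ Ggk z zH hz.
    rewrite (mact_mul (GS g Gg) (GS k Gk) zH) (hb g Gg _ kzH hkz) (hb k Gk z zH hz).
    rewrite cM// => e; apply/esym/(addrI (chi g * chi k * hval h z)).
    by rewrite -e; ring.
  have ext (A B : 'M[Cx R]_2) : A i0 i0 = B i0 i0 -> A i0 i1 = B i0 i1 ->
      A i1 i0 = B i1 i0 -> A i1 i1 = B i1 i1 -> A = B.
    move=> e00 e01 e10 e11; apply/matrixP => i j.
    have I2 (l : 'I_2) : l = i0 \/ l = i1.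
      by case: l => [[|[|//]] hl]; [left|right]; apply/val_inj.
    by case: (I2 i) => ->; case: (I2 j) => ->.
  apply: ext; rewrite mulE !(r00, r01, r10, r11).
  + by rewrite cM// mulr0 addr0.
  + by rewrite bM mulr1.
  + by rewrite mul0r mulr0 addr0.
  + by rewrite mul0r mulr1 add0r.
- by move=> g _; exact: r10.
- move=> g z Gg zH; have := hN g z Gg zH.
  (* At a pole of h both sides are infinite; elsewhere the relation defining b applies. *)
  case hz : (h z) => [v|]; last by case: (h _) => // _; rewrite /= r10 eqxx.
  move=> hgz; rewrite hS ?hgz// /msph r10 r11 mul0r add0r oner_eq0 divr1 r00 r01.
  by rewrite (hb g Gg z zH) ?hz// /hval hz.
Qed.
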